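(* Let $M=M^n$ be a Wintgen ideal submanifold of dimension $n\ge 4$ and codimension $m\ge 1$ in a real space form $\mathbb{R}^{n+m}(\widetilde{k})$. Then $C\cdot R$ and $Q(g,g\wedge\mathrm{Ricc})$ are linearly dependent if and only if $M$ is totally umbilical in $\mathbb{R}^{n+m}(\widetilde{k})$ (and hence $M$ is conformally flat).
   Context: Manifolds are connected, Riemannian and of class $C^\infty$. $\mathbb{R}^{n+m}(\widetilde{k})$ is a real space form: a Riemannian manifold of dimension $n+m$ and constant curvature $\widetilde{k}$, with metric $\widetilde{g}$. The submanifold $M$ carries the induced metric $g$ with Levi-Civita connection $\nabla$; $h$ is its second fundamental form and the shape operator $A_\xi$ for a normal field $\xi$ is given by $g(A_\xi X,Y)=\widetilde{g}(\xi,h(X,Y))$. $\{E_i\}_{i=1}^n$ is any local orthonormal tangent frame and $\{\xi_\alpha\}_{\alpha=1}^m$ any local orthonormal normal frame; $A_\alpha=A_{\xi_\alpha}$. The mean curvature vector is $\vec{H}=\frac1n\sum_i h(E_i,E_i)$ and $H=\|\vec{H}\|$. $M$ is totally umbilical if $h(X,Y)=g(X,Y)\vec{H}$. For a symmetric $(0,2)$-tensor $A$: $(X\wedge_A Y)Z=A(Y,Z)X-A(X,Z)Y$. $\mathcal{R}(X,Y)Z=\nabla_X\nabla_YZ-\nabla_Y\nabla_XZ-\nabla_{[X,Y]}Z$, $R(X,Y,Z,W)=g(\mathcal{R}(X,Y)Z,W)$, $\mathrm{Ricc}(X,Y)=\mathrm{tr}\{Z\mapsto\mathcal{R}(Z,X)Y\}$,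 $g(\mathcal{S}X,Y)=\mathrm{Ricc}(X,Y)$, $\kappa=\mathrm{tr}\,\mathcal{S}$, and the Weyl tensor is $C(X,Y,Z,W)=g(\mathcal{C}(X,Y)Z,W)$ with $\mathcal{C}(X,Y)=\mathcal{R}(X,Y)-\frac1{n-2}\left(X\wedge_g\mathcal{S}Y+\mathcal{S}X\wedge_gY-\frac{\kappa}{n-1}X\wedge_gY\right)$. The Kulkarni-Nomizu product of $(0,2)$-tensors is $(A\wedge B)(X_1,X_2;X,Y)=A(X_1,Y)B(X_2,X)+A(X_2,X)B(X_1,Y)-A(X_1,X)B(X_2,Y)-A(X_2,Y)B(X_1,X)$. For a skew family of endomorphisms $\mathcal{B}(X,Y)$ and a $(0,k)$-tensor $T$ put $(\mathcal{B}(X,Y)\cdot T)(X_1,\dots,X_k)=-\sum_{j=1}^k T(X_1,\dots,\mathcal{B}(X,Y)X_j,\dots,X_k)$. The $(0,k+2)$-tensors $R\cdot T$, $C\cdot T$, $Q(A,T)$ are defined by $(X_1,\dots,X_k;X,Y)\mapsto(\mathcal{B}(X,Y)\cdot T)(X_1,\dots,X_k)$ with $\mathcal{B}(X,Y)=\mathcal{R}(X,Y)$, $\mathcal{C}(X,Y)$, $X\wedge_AY$ respectively. Two tensors $T_1,T_2$ are called linearly dependent (on $M$) if they are linearly dependent at every point of $M$; on the set where $T_2\neq0$ this means $T_1=L\,T_2$ for some function $L$. Normalized scalar curvature: $\rho=\frac{2}{n(n-1)}\sum_{i<j}R(E_i,E_j,E_j,E_i)$. Normal curvature: $R^\perp(X,Y;\xi,\eta)=g([A_\xi,A_\eta]X,Y)$,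 and $\rho^\perp=\frac{2}{n(n-1)}\sqrt{\sum_{i<j}\sum_{\alpha<\beta}R^\perp(E_i,E_j;\xi_\alpha,\xi_\beta)^2}$. $M$ is a Wintgen ideal submanifold if $\rho=H^2-\rho^\perp+\widetilde{k}$ everywhere on $M$ (equality in the Wintgen inequality $\rho\le H^2-\rho^\perp+\widetilde{k}$). *)

(* Defs.v *)
(* Vectors are row vectors; tensor fields are written in the charts of an     *)
(* atlas, tangent vectors at a point being identified with their components.  *)
From HB Require Import structures.
From mathcomp Require Import all_boot all_order all_algebra.
From mathcomp Require Import all_classical all_reals all_analysis.

Set Implicit Arguments.
Unset Strict Implicit.
Unset Printing Implicit Defensive.

Import Order.TTheory GRing.Theory Num.Theory.
Import numFieldNormedType.Exports.

Local Open Scope classical_set_scope.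
Local Open Scope ring_scope.

Section Algebra.
Context {R : realType} {n : nat}.
Local Notation V := 'rV[R]_n.

Definition tensor4 := V -> V -> V -> V -> R.
Definition tensor6 := V -> V -> V -> V -> V -> V -> R.

Definition linearly_dependent (T1 T2 : tensor6) : Prop :=
  exists a b : R, (a != 0) || (b != 0) /\
    forall x1 x2 x3 x4 x y : V,
      a * T1 x1 x2 x3 x4 x y + b * T2 x1 x2 x3 x4 x y = 0.

Definition wedge_op (A : V -> V -> R) (x y z : V) : V :=
  A y z *: x - A x z *: y.

Definition kulkarni_nomizu (A B : V -> V -> R) : tensor4 := fun x1 x2 x y =>
  A x1 y * B x2 x + A x2 x * B x1 y - A x1 x * B x2 y - A x2 y * B x1 x.

(* (B . T)(x1, ..., x4; x, y) = (B(x, y) . T)(x1, ..., x4) *)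
Definition derivation_action (B : V -> V -> V -> V) (T : tensor4) : tensor6 :=
  fun x1 x2 x3 x4 x y =>
    - (T (B x y x1) x2 x3 x4 + T x1 (B x y x2) x3 x4
       + T x1 x2 (B x y x3) x4 + T x1 x2 x3 (B x y x4)).

Definition inner (g : 'M[R]_n) (u v : V) : R := (u *m g *m v^T) 0 0.

(* The endomorphism B' such that inner g (B' u) v = B u v, for B bilinear. *)
Definition sharp (g : 'M[R]_n) (B : V -> V -> R) (u : V) : V :=
  (\row_j B u (delta_mx 0 j)) *m invmx g.

(* lin1_mx f is the matrix whose rows are the images of the canonical basis. *)
Definition trace (f : V -> V) : R := \tr (lin1_mx f).

Definition orthonormal (g : 'M[R]_n) (k : nat) (E : 'I_k -> V) : Prop :=
  forall i j, inner g (E i) (E j) = (i == j)%:R.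

Section CurvatureTensors.
Variables (g : 'M[R]_n) (calR : V -> V -> V -> V).

Definition lower (B : V -> V -> V -> V) : tensor4 :=
  fun x y z w => inner g (B x y z) w.

Definition ricci (x y : V) : R := trace (fun z => calR z x y).

Definition ricci_op : V -> V := sharp g ricci.

Definition scalar_curvature : R := trace ricci_op.

Definition weyl_op (x y z : V) : V :=
  calR x y z - (n%:R - 2)^-1 *:
    (wedge_op (inner g) x (ricci_op y) z + wedge_op (inner g) (ricci_op x) y z
     - (scalar_curvature / (n%:R - 1)) *: wedge_op (inner g) x y z).

Definition weyl : tensor4 := lower weyl_op.

Definition C_dot_R : tensor6 := derivation_action weyl_op (lower calR).

Definition Q_g_gRicc : tensor6 :=
  derivation_action (wedge_op (inner g)) (kulkarni_nomizu (inner g) ricci).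

Definition sectional (u v : V) : R :=
  lower calR u v v u / (inner g u u * inner g v v - inner g u v ^+ 2).

Definition normalized_scalar (E : 'I_n -> V) : R :=
  2 / (n%:R * (n%:R - 1)) *
  \sum_(i < n) \sum_(j < n | (i < j)%N) lower calR (E i) (E j) (E j) (E i).

End CurvatureTensors.
End Algebra.

Section ChartGeometry.
Context {R : realType} {n : nat} (G : 'rV[R]_n -> 'M[R]_n).
Local Notation V := 'rV[R]_n.

(* The Christoffel symbols: Koszul's formula for constant vector fields. *)
Definition christoffel (x u v : V) : V :=
  sharp (G x) (fun v w => 2^-1 *
    ('D_u (fun y => inner (G y) v w) x + 'D_v (fun y => inner (G y) u w) x
     - 'D_w (fun y => inner (G y) u v) x)) v.

(* The Levi-Civita connection of G on vector fields of the chart. *)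
Definition nabla (X Y : V -> V) (x : V) : V :=
  'D_(X x) Y x + christoffel x (X x) (Y x).

Definition lie_bracket (X Y : V -> V) (x : V) : V :=
  'D_(X x) Y x - 'D_(Y x) X x.

Definition curvature_field (X Y Z : V -> V) (x : V) : V :=
  nabla X (nabla Y Z) x - nabla Y (nabla X Z) x - nabla (lie_bracket X Y) Z x.

(* By tensoriality, tangent vectors may be extended to constant fields. *)
Definition curvature (x u v w : V) : V :=
  curvature_field (cst u) (cst v) (cst w) x.

End ChartGeometry.

(* F is a coordinate expression of the immersion, G and G' the metrics of the *)
(* submanifold and of the ambient space in these coordinates.                 *)
Section ChartImmersion.
Context {R : realType} {n m : nat}.
Variables (G : 'rV[R]_n -> 'M[R]_n) (G' : 'rV[R]_(n + m) -> 'M[R]_(n + m)).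
Variables (F : 'rV[R]_n -> 'rV[R]_(n + m)) (x : 'rV[R]_n).
Local Notation V := 'rV[R]_n.
Local Notation V' := 'rV[R]_(n + m).

(* Gauss' formula, for u and v extended to constant fields of the chart. *)
Definition second_form (u v : V) : V' :=
  'D_u ('D_v F) x + christoffel G' (F x) ('D_u F x) ('D_v F x)
  - 'D_(christoffel G x u v) F x.

Definition shape_operator (xi : V') : V -> V :=
  sharp (G x) (fun u v => inner (G' (F x)) xi (second_form u v)).

Definition normal_vector (xi : V') : Prop :=
  forall u : V, inner (G' (F x)) xi ('D_u F x) = 0.

Definition mean_curvature_vector (E : 'I_n -> V) : V' :=
  n%:R^-1 *: \sum_(i < n) second_form (E i) (E i).

Definition mean_curvature (E : 'I_n -> V) : R :=
  let H := mean_curvature_vector E in Num.sqrt (inner (G' (F x)) H H).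

Definition normal_curvature (u v : V) (xi eta : V') : R :=
  let A := shape_operator in
  inner (G x) (A xi (A eta u) - A eta (A xi u)) v.

Definition normalized_normal_scalar (E : 'I_n -> V) (xi : 'I_m -> V') : R :=
  2 / (n%:R * (n%:R - 1)) *
  Num.sqrt (\sum_(i < n) \sum_(j < n | (i < j)%N)
            \sum_(a < m) \sum_(b < m | (a < b)%N)
              normal_curvature (E i) (E j) (xi a) (xi b) ^+ 2).

Definition wintgen_equality_at (k : R) : Prop :=
  forall (E : 'I_n -> V) (xi : 'I_m -> V'),
    orthonormal (G x) E ->
    orthonormal (G' (F x)) xi -> (forall a, normal_vector (xi a)) ->
    normalized_scalar (G x) (curvature G x) E
    = mean_curvature E ^+ 2 - normalized_normal_scalar E xi + k.

Definition umbilical_at : Prop :=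
  forall E : 'I_n -> V, orthonormal (G x) E ->
  forall u v : V,
    second_form u v = inner (G x) u v *: mean_curvature_vector E.

End ChartImmersion.

(* f is C^oo on the open set U: all its iterated directional derivatives are *)
(* (Frechet) differentiable on U.                                             *)
Definition smooth_on (R : realType) (n : nat) (W : normedModType R)
    (U : set 'rV[R]_n) (f : 'rV[R]_n -> W) : Prop :=
  forall (vs : seq 'rV[R]_n) (x : 'rV[R]_n), U x ->
    differentiable (foldr (fun v h => 'D_v h) f vs) x.

(* coord and param are mutually inverse bijections between dom and            *)
(* coord @` dom; their values elsewhere are irrelevant.                       *)
Record chart (R : realType) (n : nat) (T : Type) := Chart {
  dom : set T;
  coord : T -> 'rV[R]_n;
  param : 'rV[R]_n -> T }.

Definition cod (R : realType) (n : nat) (T : Type) (c : chart R n T) :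
  set 'rV[R]_n := coord c @` dom c.

Definition is_chart (R : realType) (n : nat) (T : topologicalType)
    (c : chart R n T) : Prop :=
  [/\ open (dom c), open (cod c),
      (forall p, dom c p -> param c (coord c p) = p),
      {within dom c, continuous (coord c)} &
      {within cod c, continuous (param c)}].

Definition local_dom (R : realType) (n p : nat) (S T : Type) (f : S -> T)
    (c : chart R n S) (d : chart R p T) : set 'rV[R]_n :=
  [set x | cod c x /\ dom d (f (param c x))].

Definition local_rep (R : realType) (n p : nat) (S T : Type) (f : S -> T)
    (c : chart R n S) (d : chart R p T) : 'rV[R]_n -> 'rV[R]_p :=
  fun x => coord d (f (param c x)).

Definition local_isometry_on (R : realType) (n p : nat) (U : set 'rV[R]_n)
    (G : 'rV[R]_n -> 'M[R]_n) (G' : 'rV[R]_p -> 'M[R]_p)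
    (F : 'rV[R]_n -> 'rV[R]_p) : Prop :=
  forall x, U x -> forall u v : 'rV[R]_n,
    inner (G x) u v = inner (G' (F x)) ('D_u F x) ('D_v F x).

Record manifold (R : realType) (n : nat) := Manifold {
  carrier :> topologicalType;
  atlas : set (chart R n carrier);
  manifold_hausdorff : hausdorff_space carrier;
  manifold_second_countable : @second_countable carrier;
  manifold_connected : connected [set: carrier];
  atlas_charts : forall c, atlas c -> is_chart c;
  atlas_cover : forall p, exists2 c, atlas c & dom c p;
  atlas_smooth : forall c d, atlas c -> atlas d ->
    smooth_on (local_dom id c d) (local_rep id c d) }.

(* The metric is given by its matrix in each chart c of the atlas (its values *)
(* outside cod c are irrelevant); the last field is the rule for changes of   *)
(* coordinates.                                                               *)
Record riemannian_manifold (R : realType) (n : nat) := RiemannianManifold {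
  base :> manifold R n;
  metric : chart R n base -> 'rV[R]_n -> 'M[R]_n;
  metric_smooth : forall c, atlas c -> smooth_on (cod c) (metric c);
  metric_sym : forall c x, atlas c -> cod c x -> (metric c x)^T = metric c x;
  metric_pos : forall c x, atlas c -> cod c x ->
    forall u, u != 0 -> 0 < inner (metric c x) u u;
  metric_change : forall c d, atlas c -> atlas d ->
    local_isometry_on (local_dom id c d) (metric c) (metric d)
                      (local_rep id c d) }.

Section RiemannianManifold.
Context {R : realType} {n : nat} (M : riemannian_manifold R n).

Definition constant_curvature (k : R) : Prop :=
  forall (c : chart R n M) x, atlas c -> cod c x ->
  forall u v : 'rV[R]_n, row_free (col_mx u v) ->
    sectional (metric c x) (curvature (metric c) x) u v = k.

Definition C_dot_R_Q_g_gRicc_dependent : Prop :=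
  forall (c : chart R n M) x, atlas c -> cod c x ->
    linearly_dependent
      (C_dot_R (metric c x) (curvature (metric c) x))
      (Q_g_gRicc (metric c x) (curvature (metric c) x)).

(* Meant for n >= 4 only, where local conformal flatness amounts to C = 0. *)
Definition conformally_flat : Prop :=
  forall (c : chart R n M) x, atlas c -> cod c x ->
  forall u v w z : 'rV[R]_n,
    weyl (metric c x) (curvature (metric c) x) u v w z = 0.

End RiemannianManifold.

Section Submanifold.
Context {R : realType} {n m : nat}.
Variables (M : riemannian_manifold R n) (N : riemannian_manifold R (n + m)).
Variable f : M -> N.

(* As the metric of M is positive definite, f is then an immersion, and the   *)
(* metric of M is the induced one.                                            *)
Definition isometric_immersion : Prop :=
  continuous f /\
  forall (c : chart R n M) (d : chart R (n + m) N), atlas c -> atlas d ->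
    smooth_on (local_dom f c d) (local_rep f c d) /\
    local_isometry_on (local_dom f c d) (metric c) (metric d)
                      (local_rep f c d).

Definition wintgen_ideal (k : R) : Prop :=
  forall (c : chart R n M) (d : chart R (n + m) N), atlas c -> atlas d ->
  forall x, local_dom f c d x ->
    wintgen_equality_at (metric c) (metric d) (local_rep f c d) x k.

Definition totally_umbilical : Prop :=
  forall (c : chart R n M) (d : chart R (n + m) N), atlas c -> atlas d ->
  forall x, local_dom f c d x ->
    umbilical_at (metric c) (metric d) (local_rep f c d) x.

End Submanifold.

(* Main.v *)
(* By the Gauss equation, the Wintgen equality at a point says that the traceless
   shape operators B_a of a normal frame satisfy the equality case of the DDVV
   inequality sum |[B_a, B_b]|^2 <= (sum |B_a|^2)^2.  Rotating the normal frame
   makes the B_a orthogonal, and equality then forces them all to live in a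
   single tangent plane <p, q>, with matrices (x_a, y_a; y_a, - x_a).  Hence
     R = K g-part + (g wedge D)-part - omega (p ^ q) (x) (p ^ q),
   where D is traceless on the plane and omega = sum (x_a^2 + y_a^2).  The Weyl
   tensor of such an R is an explicit multiple of omega, and for n >= 4 there are
   two further orthonormal vectors orthogonal to p and q, on which the dependence
   of C . R and Q(g, g ^ Ricc) can be tested: it forces omega = 0, that is, h = g H.
   Conversely h = g H makes the curvature constant at the point, so C = 0. *)
From HB Require Import structures.
From mathcomp Require Import all_boot all_order all_algebra.
From mathcomp Require Import all_classical all_reals all_analysis.
From mathcomp Require Import complex spectral.
From mathcomp Require Import ring lra.
Require Import Defs.

Set Implicit Arguments.
Unset Strict Implicit.
Unset Printing Implicit Defensive.

Import Order.TTheory GRing.Theory Num.Theory.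
Import numFieldNormedType.Exports.

Local Open Scope classical_set_scope.
Local Open Scope ring_scope.

(** * Orthogonal diagonalisation *)

(** The equality case rests on a row estimate: for orthonormal symmetric matrices U_t, t in J, the
    sum over t of |[U_s, U_t]|^2 is at most #|J|. In an eigenbasis of U_s with eigenvalues d_i, a
    commutator weighs the squared entries of U_t by (d_i - d_j)^2. Bessel's inequality bounds the
    total squared entry at (i, j), so only gaps larger than one can raise the sum, and as the d_i^2
    add up to one, all such gaps share an index. Unequal norms of the B_a are handled by slicing
    them into levels. Each estimate comes with its equality case, which is what produces one plane
    common to all B_a.

    The geometry enters at one point only, through few facts: the Gauss equation over a space form,
    and that h is symmetric, bilinear and normal. Proving them in charts takes the symmetry of
    second derivatives, extracted from smoothness in terms of iterated directional derivatives. No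
    formula for the derivative of an inverse metric occurs: identities between vectors are tested
    against a further vector by Koszul's formula. *)

(** Over the complex numbers the matrix is Hermitian, so its spectral decomposition yields a real
    eigenvalue. Being an eigenvalue does not depend on the field, which brings an eigenvector back
    to [R]. *)
Lemma sym_eigenvector (R : rcfType) n (A : 'M[R]_n.+1) :
  A^T = A -> exists a (v : 'rV_n.+1), v *m A = a *: v /\ v != 0.
Proof.
move=> symA; pose C := map_mx (real_complex R) A.
have hermC : C \is hermsymmx.
  apply: realsym_hermsym.
    by apply/is_hermitianmxP; rewrite expr0 scale1r map_mx_id // map_trmx symA.
  by apply/mxOverP=> i j; rewrite mxE; apply/Creal_ImP; rewrite -complexIm.
have /mxOverP/(_ 0 0) := hermitian_spectral_diag_real hermC.
have /hermitian_normalmx/orthomx_spectralP := hermC.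
set P := spectralmx C; set d := spectral_diag C => CE /Creal_ImP d0.
have uP : P \in unitmx by apply: spectral_unit.
have eigC : eigenvalue C (d 0 0).
  apply/eigenvalueP; exists (row 0 P).
    rewrite [in LHS]CE -row_mul !mulmxA mulmxV // mul1mx row_mul.
    by rewrite row_diag_mx -scalemxAl -rowE.
  apply/eqP => P0; have /(congr1 (row 0)) := mulmxV uP.
  rewrite row_mul P0 mul0mx => /matrixP/(_ 0 0); rewrite !mxE eqxx => /eqP.
  by rewrite eq_sym oner_eq0.
have [a da] : exists a, d 0 0 = real_complex R a.
  exists (complex.Re (d 0 0)); apply/eqP; rewrite eq_complex /= eqxx /=.
  by move: d0; rewrite -complexIm => /(congr1 (@complex.Re R)) /= ->.
move: eigC; rewrite da eigenvalue_map => /eigenvalueP [v va v0].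
by exists a, v.
Qed.

Lemma dot_eq0 (R : realDomainType) n (v : 'rV[R]_n) :
  ((v *m v^T) 0 0 == 0) = (v == 0).
Proof.
rewrite mxE; under eq_bigr do rewrite mxE -expr2.
rewrite psumr_eq0; last by move=> i _; apply: sqr_ge0.
apply/allP/eqP => [v0|->]; last by move=> i _; rewrite mxE expr0n eqxx.
apply/rowP => i; rewrite mxE; apply/eqP.
by have := v0 i (mem_index_enum _); rewrite /= sqrf_eq0.
Qed.

(** [H] is the reflection exchanging [e] and [v], that is, the reflection in the hyperplane
    orthogonal to [v - e]; the identity replaces it when [v = e]. *)
Lemma householder (R : realFieldType) n (v : 'rV[R]_n.+1) :
  (v *m v^T) 0 0 = 1 -> exists H : 'M[R]_n.+1, H *m H^T = 1%:M /\ row 0 H = v.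
Proof.
move=> v1; pose e : 'rV[R]_n.+1 := delta_mx 0 0; pose w := v - e.
have mxB (A B : 'M[R]_1) : (A - B) 0 0 = A 0 0 - B 0 0 by rewrite !mxE.
have eE : (e *m e^T) 0 0 = 1 by rewrite trmx_delta mul_delta_mx mxE !eqxx.
have veE : (v *m e^T) 0 0 = v 0 0 by rewrite trmx_delta -colE mxE.
have evE : (e *m v^T) 0 0 = v 0 0 by rewrite -rowE !mxE.
have [w0|w0] := eqVneq w 0.
  exists 1%:M; rewrite trmx1 mulmx1 rowE mulmx1; split=> //.
  by apply/esym/eqP; rewrite -subr_eq0 -/e -/w w0.
pose c : R := 2 - 2 * v 0 0.
have cE : (w *m w^T) 0 0 = c.
  by rewrite /w linearB /= mulmxBl !mulmxBr !mxB eE v1 veE evE /c; ring.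
have ewE : (e *m w^T) 0 0 = v 0 0 - 1.
  by rewrite /w linearB /= mulmxBr mxB eE evE.
have c0 : c != 0 by rewrite -cE dot_eq0.
pose H := 1%:M - (2 / c) *: (w^T *m w).
have HT : H^T = H.
  by rewrite /H linearB /= linearZ /= trmx_mul trmxK trmx1.
exists H; split.
  have : (w^T *m w) *m (w^T *m w) = c *: (w^T *m w).
    rewrite mulmxA -(mulmxA w^T) [w *m w^T]mx11_scalar cE mul_mx_scalar.
    by rewrite -scalemxAl.
  rewrite HT /H; move: (w^T *m w) => W WW.
  rewrite mulmxBl mul1mx mulmxBr mulmx1 -scalemxAl -scalemxAr WW !scalerA.
  rewrite -addrA -opprD addrA -scalerDl -scalerBl.
  by rewrite (_ : _ - _ = 0 :> R) ?scale0r ?subr0 //; field.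
rewrite rowE -/e /H mulmxBr mulmx1 -scalemxAr mulmxA [e *m w^T]mx11_scalar ewE.
rewrite mul_scalar_mx scalerA (_ : 2 / c * _ = -1).
  by rewrite scaleN1r opprK addrC subrK.
by rewrite /c; field.
Qed.

(** Induction on the size: a unit eigenvector becomes the first row of an orthogonal matrix, and
    conjugation by it splits off a block of size one, by symmetry both in the first row and in the
    first column. *)
Theorem sym_spectral (R : rcfType) n (A : 'M[R]_n) : A^T = A ->
  exists (P : 'M[R]_n) (d : 'rV[R]_n),
    P *m P^T = 1%:M /\ P *m A *m P^T = diag_mx d.
Proof.
elim: n A => [|n IHn] A symA.
  by exists 1%:M, 0; split; apply/matrixP => - [].
have [a [v0 [v0a v00]]] := sym_eigenvector symA.
pose v := (Num.sqrt ((v0 *m v0^T) 0 0))^-1 *: v0.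
have d0 : 0 <= (v0 *m v0^T) 0 0.
  by rewrite mxE; apply: sumr_ge0 => i _; rewrite mxE -expr2 sqr_ge0.
have va : v *m A = a *: v.
  by rewrite /v -scalemxAl v0a !scalerA mulrC.
have v1 : (v *m v^T) 0 0 = 1.
  rewrite /v linearZ /= -scalemxAl -scalemxAr scalerA mxE -expr2 exprVn.
  by rewrite sqr_sqrtr // mulVf // dot_eq0.
have [H [HH Hv]] := householder v1.
have rHA : row 0 (H *m A *m H^T) = a *: delta_mx 0 0.
  by rewrite !row_mul Hv va -scalemxAl -Hv -row_mul HH rowE mulmx1.
have symB : (H *m A *m H^T)^T = H *m A *m H^T.
  by rewrite !trmx_mul trmxK symA mulmxA.
have [B HB] : {B | H *m A *m H^T = B} by exists (H *m A *m H^T).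
rewrite HB in rHA symB.
pose B' := @drsubmx R 1 n 1 n B.
have BE : B = @block_mx R 1 n 1 n a%:M 0 0 B'.
  have B0 j : B 0 j = a * (0 == j)%:R.
    by move/rowP/(_ j): rHA; rewrite !mxE eq_sym.
  have Bj0 j : B j 0 = a * (0 == j)%:R by rewrite -B0 -[in LHS]symB mxE.
  have l0 : lshift n (0 : 'I_1) = 0 :> 'I_n.+1 by apply: val_inj.
  rewrite -[LHS](@submxK R 1 n 1 n); congr (@block_mx R 1 n 1 n _ _ _ _).
  - by apply/matrixP => i j; rewrite !ord1 !mxE l0 B0 eqxx mulr1.
  - by apply/matrixP => i j; rewrite !ord1 !mxE l0 B0 mulr0.
  - by apply/matrixP => i j; rewrite !ord1 !mxE l0 Bj0 mulr0.
have [|P [d [PP PB]]] := IHn B'.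
  by rewrite /B' trmx_drsub symB.
pose Q := @block_mx R 1 n 1 n 1%:M 0 0 P.
exists (Q *m H), (@row_mx R 1 1 n a%:M d); split.
  rewrite trmx_mul mulmxA -(mulmxA Q) HH mulmx1 /Q.
  rewrite (@tr_block_mx R 1 n 1 n) (@mulmx_block R 1 n 1 n 1 n) !trmx0 trmx1.
  rewrite !mulmx0 !mul0mx !addr0 add0r mulmx1 PP.
  by rewrite -scalar_mx_block.
rewrite trmx_mul !mulmxA -!(mulmxA Q) HB BE /Q.
rewrite (@tr_block_mx R 1 n 1 n) !(@mulmx_block R 1 n 1 n 1 n) !trmx0 trmx1.
rewrite !(mulmx0, mul0mx, mulmx1, mul1mx, addr0, add0r) mulmxA PB.
apply: etrans (esym (diag_mx_row (a%:M : 'rV_1) d)).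
congr (@block_mx R 1 n 1 n _ _ _ _).
by apply/matrixP => i j; rewrite !ord1 !mxE.
Qed.

Definition posdef (R : numDomainType) n (g : 'M[R]_n) :=
  g^T = g /\ forall u : 'rV_n, u != 0 -> 0 < (u *m g *m u^T) 0 0.

Lemma posdef_unit (R : numFieldType) n (g : 'M[R]_n) : posdef g -> g \in unitmx.
Proof.
move=> [_ gpos]; rewrite -row_free_unit -kermx_eq0; apply/eqP/row_matrixP => i.
rewrite row0; have [//|/gpos] := eqVneq (row i (kermx g)) 0.
by rewrite -row_mul mulmx_ker row0 mul0mx mxE ltxx.
Qed.

Lemma posdef_congr (R : numFieldType) n r (g : 'M[R]_n) (K : 'M[R]_(r, n)) :
  posdef g -> row_free K -> posdef (K *m g *m K^T).
Proof.
move=> [gs gpos] fK; split; first by rewrite !trmx_mul trmxK gs mulmxA.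
move=> u u0; have /gpos : u *m K != 0.
  by apply: contraNneq u0 => uK; apply/eqP/(row_free_inj fK); rewrite uK mul0mx.
by rewrite trmx_mul !mulmxA.
Qed.

Lemma posdef_frame (R : rcfType) n (g : 'M[R]_n) : posdef g ->
  exists P : 'M[R]_n, P *m g *m P^T = 1%:M.
Proof.
move=> [gs gpos]; have [P [d [PP Pd]]] := sym_spectral gs.
have d0 i : 0 < d 0 i.
  have -> : d 0 i = (row i P *m g *m (row i P)^T) 0 0.
    have /matrixP/(_ i i) := Pd; rewrite [in RHS]mxE eqxx mulr1n => <-.
    by rewrite rowE trmx_mul trmx_delta !mulmxA -colE -!mulmxA -rowE !mxE.
  apply: gpos; apply/eqP => Pi0; have /(congr1 (row i)) := PP.
  rewrite row_mul Pi0 mul0mx => /rowP/(_ i); rewrite !mxE eqxx => /eqP.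
  by rewrite eq_sym oner_eq0.
exists (diag_mx (\row_i (Num.sqrt (d 0 i))^-1) *m P).
rewrite trmx_mul tr_diag_mx mulmxA -!(mulmxA (diag_mx _)) mulmxA Pd.
rewrite -mulmxA !mul_diag_mx; apply/matrixP => i j; rewrite !mxE.
have [->|ij] := eqVneq; last by rewrite !mulr0n !mulr0.
rewrite mulr1n mulrCA -expr2 exprVn sqr_sqrtr ?mulfV ?gt_eqF //.
exact: ltW.
Qed.

Lemma posdef_complement_frame (R : rcfType) n m (g : 'M[R]_(n + m))
    (J : 'M[R]_(n, n + m)) : posdef g -> row_free J ->
  exists X : 'M[R]_(m, n + m), X *m g *m J^T = 0 /\ X *m g *m X^T = 1%:M.
Proof.
move=> gp fJ; have gu := posdef_unit gp.
have rk : \rank (kermx (g *m J^T)) = m.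
  rewrite mxrank_ker -mxrank_tr trmx_mul trmxK mxrankMfree; last first.
    by rewrite row_free_unit unitmx_tr.
  by move/eqP: fJ => ->; rewrite addKn.
have [K [fK KJ]] : exists K : 'M[R]_(m, n + m), row_free K /\ K *m g *m J^T = 0.
  (* A basis of the kernel has a rank as its number of rows; quantifying over that number lets [rk]
     turn it into [m] in the type. *)
  suff: forall r, \rank (kermx (g *m J^T)) = r ->
      exists K : 'M[R]_(r, n + m), row_free K /\ K *m g *m J^T = 0 by apply.
  move=> _ <-.
  exists (row_base (kermx (g *m J^T))); split; first exact: row_base_free.
  by rewrite -mulmxA; apply/sub_kermxP; rewrite eq_row_base.
have [P PK] := posdef_frame (posdef_congr gp fK).
exists (P *m K); split; first by rewrite -!mulmxA [K *m _]mulmxA KJ mulmx0.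
by rewrite trmx_mul !mulmxA in PK *.
Qed.

(** * The equality case of the DDVV inequality *)

Section StarInequality.
Variables (R : realFieldType) (n : nat) (d : 'I_n -> R).
Hypothesis d1 : \sum_i d i ^+ 2 = 1.

Lemma sum_sqr_uniq (s : seq 'I_n) : uniq s -> \sum_(i <- s) d i ^+ 2 <= 1.
Proof.
move=> us; rewrite -d1 big_uniq //= [leRHS](bigID (mem s)) /= lerDl.
by apply: sumr_ge0 => i _; apply: sqr_ge0.
Qed.

Lemma wide_neq i j : 1 < (d i - d j) ^+ 2 -> i != j.
Proof. by apply: contraTneq => ->; rewrite subrr expr0n ltNge ler01. Qed.

Lemma wide_lt0 i j : 1 < (d i - d j) ^+ 2 -> d i * d j < 0.
Proof.
move=> wij; have := @sum_sqr_uniq [:: i; j].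
rewrite /= inE (wide_neq wij) !big_cons big_nil => /(_ isT); nra.
Qed.

(** For four distinct indices the two squared gaps add up to at most twice the sum of the four
    squares, hence to at most 2. *)
Lemma wide_meet i j k l :
  1 < (d i - d j) ^+ 2 -> 1 < (d k - d l) ^+ 2 -> ~~ uniq [:: i; j; k; l].
Proof.
move=> wij wkl; apply/negP => /sum_sqr_uniq.
by rewrite !big_cons big_nil; have := sqr_ge0 (d i + d j); have := sqr_ge0 (d k + d l); nra.
Qed.

(* Any two pairs at distance > 1 meet by wide_meet, so the only alternative to *)
(* a star is a triangle; but wide_lt0 leaves no consistent choice of signs for *)
(* its three vertices.                                                         *)
Lemma wide_star :
  exists c, forall i j, 1 < (d i - d j) ^+ 2 -> (i == c) || (j == c).
Proof.
pose star c := [forall i, forall j, (1 < (d i - d j) ^+ 2) ==> ((i == c) || (j == c))].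
have starP c : star c -> forall i j, 1 < (d i - d j) ^+ 2 -> (i == c) || (j == c).
  by move=> /forallP sc i j; have /forallP/(_ j)/implyP := sc i.
have sym i j : (d i - d j) ^+ 2 = (d j - d i) ^+ 2 by ring.
have [/existsP[a /existsP[b wab]]|none] :=
  boolP [exists a, exists b, 1 < (d a - d b) ^+ 2]; last first.
  case: n d d1 none star starP sym => [d' |n' d' _ none _ _ _].
    by rewrite big_ord0 => /eqP; rewrite eq_sym oner_eq0.
  exists ord0 => i j wij; case/negP: none.
  by apply/existsP; exists i; apply/existsP; exists j.
have nab := wide_neq wab.
case: (boolP (star a)) => [/starP sa|]; first by exists a.
case: (boolP (star b)) => [/starP sb|]; first by exists b.
have nstarP e : ~~ star e -> exists i j, [/\ 1 < (d i - d j) ^+ 2, i != e & j != e].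
  rewrite negb_forall => /existsP[x]; rewrite negb_forall => /existsP[y].
  by rewrite negb_imply negb_or => /and3P[? ? ?]; exists x, y.
have other c e i j : 1 < (d c - d e) ^+ 2 -> 1 < (d i - d j) ^+ 2 ->
    i != e -> j != e -> exists2 k, k != e & 1 < (d k - d c) ^+ 2.
  move=> wce wij ie je; have := wide_meet wce wij.
  have ? := wide_neq wce; have ? := wide_neq wij.
  have [ic _|ic] := eqVneq i c; first by exists j => //; rewrite sym -ic.
  have [jc _|jc] := eqVneq j c; first by exists i => //; rewrite -jc.
  rewrite /= !inE !negb_or; case/negP; apply/and4P; split=> //.
    by apply/and3P; split => //; rewrite eq_sym.
  by apply/andP; split; rewrite eq_sym.
move=> /nstarP[k [l [wkl kb lb]]] /nstarP[i [j [wij ia ja]]].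
have wba : 1 < (d b - d a) ^+ 2 by rewrite sym.
have [x xa wxb] := other b a i j wba wij ia ja.
have [y yb wya] := other a b k l wab wkl kb lb.
have xy : x = y.
  have := wide_meet wxb wya; rewrite /= !inE !negb_or (wide_neq wxb) xa.
  rewrite (wide_neq wya) (eq_sym b y) yb (eq_sym b a) nab /= !andbT.
  by rewrite negbK => /eqP.
rewrite -{}xy in wya.
have := wide_lt0 wab; have := wide_lt0 wxb; have := wide_lt0 wya.
move: (d x) (d a) (d b) => X A B h1 h2 h3.
have : 0 < (X * A) * (X * B) by rewrite nmulr_rgt0.
rewrite (_ : _ * _ = X ^+ 2 * (A * B)); last by ring.
by rewrite ltNge mulr_ge0_le0 // ?sqr_ge0 ?ltW.
Qed.

Variables (c : 'I_n) (J : {set 'I_n}).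
Hypothesis cJ : c \notin J.

(** The sum of squares is the slack of the star inequality. Write t for [d c ^+ 2] plus the squares
    over [J], and X for the last sum: as t <= 1, the right-hand side is at most s (1 - X). Hence X
    <= 1, and X = 1 forces t = 1 and [d c + s * d j = 0] on [J]. *)
Let star_sum_sqr (s : R) : s = #|J|%:R ->
  \sum_(j in J) (d c + s * d j) ^+ 2 =
  (s + 1) * (d c ^+ 2 + \sum_(j in J) d j ^+ 2) * s - s ^+ 2
  - s * (\sum_(j in J) ((d c - d j) ^+ 2 - 1)).
Proof.
move=> sE; have sc x : \sum_(j in J) x = s * x :> R.
  by rewrite sumr_const sE mulr_natl.
have E1 j : (d c + s * d j) ^+ 2 =
  d c ^+ 2 + (2 * s * d c * d j + s ^+ 2 * d j ^+ 2) by ring.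
have E2 j : (d c - d j) ^+ 2 - 1 =
  (d c ^+ 2 - 1) + ((- 2 * d c) * d j + d j ^+ 2) by ring.
rewrite (eq_bigr _ (fun j _ => E1 j)) [in RHS](eq_bigr _ (fun j _ => E2 j)).
by rewrite !big_split /= -!mulr_sumr !sc; ring.
Qed.

Let star_sqr_le : d c ^+ 2 + \sum_(j in J) d j ^+ 2 <= 1.
Proof.
have := @sum_sqr_uniq (c :: enum J); rewrite /= enum_uniq mem_enum cJ.
by rewrite big_cons big_enum /=; apply.
Qed.

Lemma star_sum_le : \sum_(j in J) ((d c - d j) ^+ 2 - 1) <= 1.
Proof.
have h0 : 0 <= \sum_(j in J) (d c + #|J|%:R * d j) ^+ 2.
  by apply: sumr_ge0 => j _; apply: sqr_ge0.
have [/eqP J0|Jn0] := boolP (#|J| == 0)%N.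
  by rewrite (cards0_eq J0) big_set0 ler01.
have s1 : 0 < #|J|%:R :> R by rewrite ltr0n lt0n.
move: h0; rewrite star_sum_sqr //.
move: star_sqr_le s1; move: (d c ^+ 2 + _) (\sum_(j in J) (_ - 1)) (#|J|%:R : R) => t X s.
move=> t1 s1 h; rewrite -(ler_pM2l s1) mulr1; nra.
Qed.

Lemma star_sum_eq : \sum_(j in J) ((d c - d j) ^+ 2 - 1) = 1 ->
  [/\ (0 < #|J|)%N, (forall j, j \in J -> d j = - d c / #|J|%:R) &
      forall j, j \notin J -> j != c -> d j = 0].
Proof.
move=> X1; have Jn0 : (0 < #|J|)%N.
  rewrite lt0n; apply: contra_eq_neq X1 => /eqP/eqP/cards0_eq->.
  by rewrite big_set0 eq_sym oner_eq0.
have s1 : 0 < #|J|%:R :> R by rewrite ltr0n.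
have [S0 t1] : \sum_(j in J) (d c + #|J|%:R * d j) ^+ 2 = 0 /\
    d c ^+ 2 + \sum_(j in J) d j ^+ 2 = 1.
  have : 0 <= \sum_(j in J) (d c + #|J|%:R * d j) ^+ 2.
    by apply: sumr_ge0 => j _; apply: sqr_ge0.
  have := star_sqr_le.
  rewrite star_sum_sqr // X1; move: (d c ^+ 2 + _) (#|J|%:R : R) s1 => t s s1 tl h.
  suff -> : t = 1 by split=> //; ring.
  by apply/eqP; rewrite eq_le tl /=; rewrite -(ler_pM2l s1); nra.
split=> //.
  move=> j jJ; have /eqP := S0.
  rewrite psumr_eq0 => [|i _]; last exact: sqr_ge0.
  move=> /allP/(_ j (mem_index_enum _)).
  rewrite jJ /= sqrf_eq0 addr_eq0 => /eqP ->.
  by rewrite opprK mulrC mulKf // gt_eqF.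
move=> j jJ jc; have := @sum_sqr_uniq (j :: c :: enum J).
rewrite /= inE negb_or mem_enum jc jJ enum_uniq mem_enum cJ => /(_ isT).
rewrite !big_cons big_enum /= t1 gerDr => h.
by apply/eqP; rewrite -sqrf_eq0 eq_le h sqr_ge0.
Qed.

End StarInequality.

Lemma sum_cross (R : nmodType) (I : finType) (c : I) (J : {set I})
    (f : I -> I -> R) :
  \sum_i \sum_j (if (i == c) && (j \in J) then f i j else 0) =
  \sum_(j in J) f c j.
Proof.
rewrite (bigD1 c) //= [X in _ + X]big1 ?addr0; last first.
  by move=> i /negPf ic; rewrite big1 // => j _; rewrite ic.
by rewrite eqxx /= -big_mkcond.
Qed.

Lemma sumr_eq_termwise (R : numDomainType) (I : finType) (f g : I -> R) :
  (forall i, f i <= g i) -> \sum_i f i = \sum_i g i -> forall i, f i = g i.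
Proof.
move=> fg /eqP; rewrite eq_sym -subr_eq0 -sumrB psumr_eq0; last first.
  by move=> i _; rewrite subr_ge0.
move=> /allP s0 i; have := s0 i (mem_index_enum _).
by rewrite /= subr_eq0 => /eqP.
Qed.

Lemma sumr_eq_termwise2 (R : numDomainType) (I J : finType) (f g : I -> J -> R) :
  (forall i j, f i j <= g i j) ->
  \sum_i \sum_j f i j = \sum_i \sum_j g i j -> forall i j, f i j = g i j.
Proof.
move=> fg eq i; apply: sumr_eq_termwise => //.
apply: (@sumr_eq_termwise _ _ (fun i => \sum_j f i j) (fun i => \sum_j g i j)) => //.
by move=> k; apply: ler_sum.
Qed.

Section WeightedStar.
Variables (R : realFieldType) (n : nat) (d : 'I_n -> R) (v : 'I_n -> 'I_n -> R).
Hypothesis d1 : \sum_i d i ^+ 2 = 1.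
Hypothesis v_ge0 : forall i j, 0 <= v i j.
Hypothesis v_le : forall i j, i != j -> v i j <= 2^-1.

Let X i j := (d i - d j) ^+ 2 - 1.
Let J (c : 'I_n) : {set 'I_n} := [set j | (j != c) && (1 < (d c - d j) ^+ 2)]%SET.
(** [Y c] puts half of the excess [X c j] on each of (c, j) and (j, c). It dominates
    [X i j * v i j]: a positive excess occurs only on the star, where the weight is at most 1/2, and
    elsewhere the product is not positive. *)
Let Y (c i j : 'I_n) := (if (i == c) && (j \in J c) then X i j / 2 else 0)
  + (if (j == c) && (i \in J c) then X j i / 2 else 0).

Let XC i j : X i j = X j i. Proof. by rewrite /X; ring. Qed.

Let sumY c : \sum_i \sum_j Y c i j = \sum_(j in J c) X c j.
Proof.
under eq_bigr do rewrite big_split /=.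
rewrite big_split /= (sum_cross c (J c) (fun i j => X i j / 2)).
rewrite exchange_big (sum_cross c (J c) (fun i j => X i j / 2)) /= -big_split /=.
by apply: eq_bigr => j _; field.
Qed.

Let wideE i j : (1 < (d i - d j) ^+ 2) = (0 < X i j).
Proof. by rewrite subr_gt0. Qed.

Let le_XY c : (forall i j, 1 < (d i - d j) ^+ 2 -> (i == c) || (j == c)) ->
  forall i j, X i j * v i j <= Y c i j.
Proof.
move=> star i j.
have J0 k l : X k l <= 0 -> (k == c) && (l \in J c) = false.
  move=> X0; apply/negbTE/negP => /andP[/eqP kc].
  by rewrite inE wideE -kc ltNge X0 andbF.
have [X0|X0] := leP (X i j) 0.
  have X0' : X j i <= 0 by rewrite XC.
  by rewrite /Y (J0 _ _ X0) (J0 _ _ X0') addr0 mulr_le0_ge0.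
have ij : i != j by apply: (@wide_neq _ _ d); rewrite wideE.
have Xv : X i j * v i j <= X i j / 2 by rewrite ler_pM2l // v_le.
have wij : 1 < (d i - d j) ^+ 2 by rewrite wideE.
rewrite /Y; have /orP[/eqP ic|/eqP jc] := star i j wij.
  have jc : j != c by rewrite -ic eq_sym.
  by rewrite !inE (negPf jc) wideE -ic eqxx X0 /= addr0.
have ic : i != c by rewrite -jc.
have X0' : 0 < X j i by rewrite XC.
by rewrite !inE (negPf ic) -jc eqxx !wideE X0' /= add0r (XC j).
Qed.

Let cJ c : c \notin J c. Proof. by rewrite inE eqxx. Qed.

Lemma star_weight_le : \sum_i \sum_j ((d i - d j) ^+ 2 - 1) * v i j <= 1.
Proof.
have [c star] := wide_star d1.
apply: (le_trans _ (star_sum_le d1 (cJ c))); rewrite -sumY.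
by apply: ler_sum => i _; apply: ler_sum => j _; apply: le_XY.
Qed.

(** Equality holds termwise, so a nonzero weight off the star needs a squared gap of exactly 1. This
    cannot occur: away from the centre [d] only takes the values 0 and e = [- d c / #|J c|%:R], and
    [d c ^+ 2] and e^2 are both positive with sum at most 1. *)
Lemma star_weight_eq : \sum_i \sum_j ((d i - d j) ^+ 2 - 1) * v i j = 1 ->
  exists c (K : {set 'I_n}), [/\ c \notin K, (0 < #|K|)%N,
    (forall j, j \in K -> d j = - d c / #|K|%:R),
    (forall j, j \notin K -> j != c -> d j = 0) &
    forall i j, v i j != 0 -> (i == c) && (j \in K) || (j == c) && (i \in K)].
Proof.
have [c star] := wide_star d1 => V1.
have S1 : \sum_(j in J c) ((d c - d j) ^+ 2 - 1) = 1.
  apply: le_anti; rewrite star_sum_le // -[leLHS]V1 -sumY.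
  by apply: ler_sum => i _; apply: ler_sum => j _; apply: le_XY.
have [J0 dJ dN] := star_sum_eq d1 (cJ c) S1.
exists c, (J c); split=> // i j vij; apply/negPn/negP.
rewrite negb_or => /andP[/negPf n1 /negPf n2].
have := @sumr_eq_termwise2 _ _ _ _ _ (le_XY star) _ i j.
rewrite sumY V1 S1 /Y n1 n2 addr0 => /(_ erefl)/eqP.
rewrite mulf_eq0 (negPf vij) orbF => /eqP X0.
have X1 : (d i - d j) ^+ 2 = 1 by apply/eqP; rewrite -subr_eq0; apply/eqP.
have dcN0 : d c != 0.
  apply/eqP => dc0; move/eqP: d1; rewrite big1 1?eq_sym ?oner_eq0 // => k _.
  have [kJ|kJ] := boolP (k \in J c); first by rewrite dJ // dc0 oppr0 mul0r expr0n.
  by have [->|kc] := eqVneq k c; rewrite ?dc0 ?dN // expr0n.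
have s0 : #|J c|%:R != 0 :> R by rewrite pnatr_eq0 -lt0n.
have [k kJ] : exists k, k \in J c by apply/set0Pn; rewrite -card_gt0.
have : d c ^+ 2 + (- d c / #|J c|%:R) ^+ 2 <= 1.
  rewrite -(dJ k kJ); have := @sum_sqr_uniq _ _ _ d1 [:: c; k].
  rewrite /= inE !big_cons big_nil addr0; apply; rewrite andbT.
  by apply: contraTneq kJ => <-; apply: cJ.
have dcs0 : 0 < (- d c / #|J c|%:R) ^+ 2.
  by rewrite exprn_even_gt0 //= mulf_neq0 // ?oppr_eq0 // invr_neq0.
have dc0 : 0 < d c ^+ 2 by rewrite exprn_even_gt0.
move=> le1.
have val l : l != c -> d l = 0 \/ d l = - d c / #|J c|%:R.
  by move=> lc; have [/dJ|/dN] := boolP (l \in J c); [right|left; auto].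
move: n1 n2 X1; have [->|ic] := eqVneq i c; have [->|jc] := eqVneq j c => /=.
- by rewrite subrr expr0n => _ _ /eqP; rewrite eq_sym oner_eq0.
- move=> /negbT jJ _; rewrite (dN j) // subr0 => dc1.
  by move: le1; rewrite dc1 gerDl leNgt dcs0.
- move=> _ /negbT iJ; rewrite (dN i) // sub0r sqrrN => dc1.
  by move: le1; rewrite dc1 gerDl leNgt dcs0.
move: (val i ic) (val j jc) dcs0 le1; move: (- d c / _) => e.
by move=> [->|->] [->|->]; rewrite ?subrr ?subr0 ?sub0r ?sqrrN ?expr0n /=; lra.
Qed.

End WeightedStar.

(** For a = c 1_I + a', the numbers [X], [Y], [Z] are the parts of the quadratic form on the layer,
    mixed, and on the remainder [a']; [k] is the size of I and [s] the sum of [a']. Positivity of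
    [c] is what transfers equality to the layer. *)
Lemma layer_cake_step (R : realFieldType) (c k s X Y Z : R) :
  0 < c -> 0 <= k -> 0 <= s -> X <= k ^+ 2 -> Y <= k * s -> Z <= s ^+ 2 ->
  c ^+ 2 * X + 2 * c * Y + Z <= (c * k + s) ^+ 2 /\
  (c ^+ 2 * X + 2 * c * Y + Z = (c * k + s) ^+ 2 -> X = k ^+ 2).
Proof.
move=> c0 k0 s0 hX hY hZ.
have e1 : c ^+ 2 * X <= c ^+ 2 * k ^+ 2 by rewrite ler_wpM2l // sqr_ge0.
have e2 : 2 * c * Y <= 2 * c * (k * s) by rewrite ler_wpM2l // mulr_ge0 // ltW.
have e3 : (c * k + s) ^+ 2 = c ^+ 2 * k ^+ 2 + 2 * c * (k * s) + s ^+ 2 by ring.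
split; rewrite e3; first lra.
move=> e4; have : c ^+ 2 * X = c ^+ 2 * k ^+ 2 by lra.
by apply: mulfI; rewrite expf_neq0 // gt_eqF.
Qed.

(** * Quadratic forms with bounded rows, by slicing into layers *)

Section LayerCake.
Variables (R : realFieldType) (T : finType) (p : T -> T -> R).
Hypothesis pC : forall s t, p s t = p t s.

Definition positive_part (a : T -> R) : {set T} := [set t | 0 < a t]%SET.

(* Induction on the support of a: subtracting its least positive value c from  *)
(* a on the support I leaves a smaller support, and the terms in c are         *)
(* controlled by the row bounds on I.                                          *)
Lemma layer_cake (a : T -> R) : (forall t, 0 <= a t) ->
  (forall I : {set T}, I \subset positive_part a ->
    forall s, s \in I -> \sum_(t in I) p s t <= #|I|%:R) ->
  \sum_s \sum_t a s * a t * p s t <= (\sum_s a s) ^+ 2 /\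
  (\sum_s \sum_t a s * a t * p s t = (\sum_s a s) ^+ 2 ->
    forall s, s \in positive_part a ->
      \sum_(t in positive_part a) p s t = #|positive_part a|%:R).
Proof.
have [k] := ubnP #|positive_part a|; elim: k a => // k IHk a ak a0 hp.
set I := positive_part a in ak hp *.
have aI t : t \notin I -> a t = 0.
  by rewrite inE lt_neqAle a0 andbT negbK => /eqP ->.
have [I0|[t0 t0I]] := set_0Vmem I.
  have az t : a t = 0 by apply: aI; rewrite I0 inE.
  split=> [|_ s]; last by rewrite I0 inE.
  by rewrite !big1 ?expr0n // => s _; rewrite big1 // => t _; rewrite az !mul0r.
pose t1 := [arg min_(t < t0 in I) a t]%O.
have [t1I t1min] : t1 \in I /\ forall t, t \in I -> a t1 <= a t.
  by rewrite /t1; case: Order.TotalTheory.arg_minP => // i iI im; split.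
pose c := a t1; have c0 : 0 < c by move: t1I; rewrite inE.
pose a' t := if t \in I then a t - c else 0.
have aE t : a t = c * (t \in I)%:R + a' t.
  rewrite /a'; case: ifPn => [_|/aI ->]; first by rewrite mulr1 addrC subrK.
  by rewrite mulr0 addr0.
have a'0 t : 0 <= a' t.
  by rewrite /a'; case: ifP => // /t1min; rewrite subr_ge0.
have I'I : positive_part a' \proper I.
  apply/properP; split; last first.
    by exists t1 => //; rewrite inE /a' t1I subrr ltxx.
  by apply/fintype.subsetP => t; rewrite inE /a'; case: ifP => //; rewrite ltxx.
(* The row bounds are assumed on every subset of the support, hence remain available on the smaller
   support of [a']. *)
have [||Z _] := IHk a' _ a'0.
- by rewrite (leq_trans _ (_ : #|I| <= k)%N) //; exact: proper_card.
- by move=> K Ksub; apply: hp; apply: fintype.subset_trans Ksub (proper_sub I'I).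
pose q s := \sum_(t in I) p s t.
have qI s : s \in I -> q s <= #|I|%:R by apply: hp.
have SE : \sum_s a s = c * #|I|%:R + \sum_s a' s.
  rewrite (eq_bigr _ (fun s _ => aE s)) big_split /= -mulr_sumr; congr (_ * _ + _).
  rewrite -sum1_card natr_sum [RHS]big_mkcond /=.
  by apply: eq_bigr => t _; case: (t \in I).
have TE : \sum_s \sum_t a s * a t * p s t =
    c ^+ 2 * (\sum_(s in I) q s) + 2 * c * (\sum_s a' s * q s) +
    \sum_s \sum_t a' s * a' t * p s t.
  have qE s : q s = \sum_t (t \in I)%:R * p s t.
    rewrite /q big_mkcond; apply: eq_bigr => t _.
    by case: ifP; rewrite ?mul1r ?mul0r.
  have E1 : \sum_(s in I) q s = \sum_s \sum_t (s \in I)%:R * (t \in I)%:R * p s t.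
    rewrite big_mkcond; apply: eq_bigr => s _; rewrite qE.
    case: ifP => _; first by apply: eq_bigr => t _; rewrite mul1r.
    by rewrite big1 // => t _; rewrite !mul0r.
  have E2 : \sum_s a' s * q s = \sum_s \sum_t a' s * (t \in I)%:R * p s t.
    by apply: eq_bigr => s _; rewrite qE mulr_sumr; apply: eq_bigr => t _; rewrite mulrA.
  have E3 : \sum_s a' s * q s = \sum_s \sum_t (s \in I)%:R * a' t * p s t.
    rewrite E2 exchange_big; apply: eq_bigr => s _; apply: eq_bigr => t _.
    by rewrite pC (mulrC (a' t)).
  rewrite mulr_natl mulrnAl mulr2n {2}E3 {1}E2 E1 !mulr_sumr -!big_split /=.
  apply: eq_bigr => s _; rewrite !mulr_sumr -!big_split /=.
  by apply: eq_bigr => t _; rewrite [in LHS](aE s) [in LHS](aE t); ring.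
have hX : \sum_(s in I) q s <= #|I|%:R ^+ 2.
  rewrite expr2 mulr_natl -sumr_const; apply: ler_sum; exact: qI.
have hY : \sum_s a' s * q s <= #|I|%:R * \sum_s a' s.
  rewrite mulr_sumr; apply: ler_sum => s _; rewrite mulrC.
  have [sI|sI] := boolP (s \in I); first by rewrite ler_wpM2r // qI.
  by rewrite /a' (negPf sI) !mulr0.
have S0 : 0 <= \sum_s a' s by apply: sumr_ge0.
have [le1 eq1] := layer_cake_step c0 (ler0n R #|I|) S0 hX hY Z.
rewrite TE SE; split=> // /eq1 X1 s sI.
apply/eqP; rewrite eq_le qI //=.
rewrite leNgt; apply/negP => lt1.
suff : \sum_(s in I) q s < #|I|%:R ^+ 2 by rewrite X1 ltxx.
rewrite expr2 mulr_natl -sumr_const (bigD1 s) //= [ltRHS](bigD1 s) //=.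
by apply: ltr_leD => //; apply: ler_sum => t /andP[tI _]; apply: qI.
Qed.

End LayerCake.

(** * The Frobenius product and commutators *)

Section Frobenius.
Variables (R : realFieldType) (n : nat).
Implicit Types A B E P : 'M[R]_n.

Definition frob A B := \tr (A *m B^T).
Definition comm A B := A *m B - B *m A.

Lemma frobE A B : frob A B = \sum_i \sum_j A i j * B i j.
Proof.
apply: eq_bigr => i _; rewrite mxE; apply: eq_bigr => j _.
by rewrite [B^T _ _]mxE.
Qed.

Lemma frobC A B : frob A B = frob B A.
Proof. by rewrite /frob -mxtrace_tr trmx_mul trmxK. Qed.

Lemma frob_ge0 A : 0 <= frob A A.
Proof.
rewrite frobE; apply: sumr_ge0 => i _; apply: sumr_ge0 => j _.
by rewrite -expr2 sqr_ge0.
Qed.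

Lemma frob_eq0 A : frob A A = 0 -> A = 0.
Proof.
move=> A0; apply/matrixP => i j; rewrite mxE; apply/eqP; rewrite -sqrf_eq0.
have := @sumr_eq_termwise2 _ _ _ (fun _ _ => 0) (fun i j => A i j ^+ 2) _ _ i j.
move=> <- //; first by move=> *; apply: sqr_ge0.
rewrite big1 => [|k _]; last by rewrite big1.
rewrite -[LHS]A0 frobE; apply: eq_bigr => k _; apply: eq_bigr => l _.
by rewrite expr2.
Qed.

Lemma frob_delta A i j : frob A (delta_mx i j) = A i j.
Proof.
rewrite frobE (bigD1 i) //= [X in _ + X]big1 ?addr0; last first.
  by move=> k /negPf ki; rewrite big1 // => l _; rewrite mxE ki mulr0.
rewrite (bigD1 j) //= big1 ?addr0 ?mxE ?eqxx ?mulr1 // => l /negPf lj.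
by rewrite mxE lj andbF mulr0.
Qed.

Lemma frobDl A B E : frob (A + B) E = frob A E + frob B E.
Proof. by rewrite /frob mulmxDl mxtraceD. Qed.

Lemma frobZl c A B : frob (c *: A) B = c * frob A B.
Proof. by rewrite /frob -scalemxAl mxtraceZ. Qed.

Lemma frobDr A B E : frob E (A + B) = frob E A + frob E B.
Proof. by rewrite frobC frobDl !(frobC E). Qed.

Lemma frobZr c A B : frob A (c *: B) = c * frob A B.
Proof. by rewrite frobC frobZl frobC. Qed.

Lemma frob_suml (T : finType) (I : {set T}) (F : T -> 'M[R]_n) E :
  frob (\sum_(t in I) F t) E = \sum_(t in I) frob (F t) E.
Proof. by rewrite /frob mulmx_suml raddf_sum. Qed.

Lemma frob_sumr (T : finType) (I : {set T}) (F : T -> 'M[R]_n) E :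
  frob E (\sum_(t in I) F t) = \sum_(t in I) frob E (F t).
Proof. by rewrite frobC frob_suml; apply: eq_bigr => t _; rewrite frobC. Qed.

(** [Y] is the orthogonal projection of [E] on the span of the [B t]; the inequality says that
    [E - Y] has nonnegative square norm. *)
Lemma bessel (T : finType) (I : {set T}) (B : T -> 'M[R]_n) E :
  (forall s t, s \in I -> t \in I -> frob (B s) (B t) = (s == t)%:R) ->
  \sum_(t in I) frob (B t) E ^+ 2 <= frob E E.
Proof.
move=> oB; pose Y := \sum_(t in I) frob (B t) E *: B t.
have YE : frob Y E = \sum_(t in I) frob (B t) E ^+ 2.
  by rewrite frob_suml; apply: eq_bigr => t _; rewrite frobZl expr2.
have YY : frob Y Y = \sum_(t in I) frob (B t) E ^+ 2.
  rewrite {1}/Y frob_suml; apply: eq_bigr => t tI.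
  rewrite frobZl frob_sumr (bigD1 t) //= frobZr oB // eqxx mulr1.
  rewrite big1 ?addr0 ?expr2 // => s /andP[sI st].
  by rewrite frobZr oB // eq_sym (negPf st) mulr0.
have := frob_ge0 (E - Y); rewrite -scaleN1r !(frobDl, frobDr, frobZl, frobZr).
rewrite (frobC E Y) YE YY; lra.
Qed.

Definition orthogonal_mx P := P *m P^T = 1%:M.

Lemma orthogonal_mxC P : orthogonal_mx P -> P^T *m P = 1%:M.
Proof. exact: mulmx1C. Qed.

Definition conj P A := P *m A *m P^T.

Lemma conjM P A B : orthogonal_mx P -> conj P A *m conj P B = conj P (A *m B).
Proof.
move=> /orthogonal_mxC PP; rewrite /conj !mulmxA.
by rewrite -(mulmxA (P *m A)) PP mulmx1.
Qed.

Lemma conjT P A : (conj P A)^T = conj P A^T.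
Proof. by rewrite /conj !trmx_mul trmxK mulmxA. Qed.

Lemma trace_conj P A : orthogonal_mx P -> \tr (conj P A) = \tr A.
Proof.
by move=> /orthogonal_mxC PP; rewrite /conj mxtrace_mulC mulmxA PP mul1mx.
Qed.

Lemma frob_conj P A B : orthogonal_mx P -> frob (conj P A) (conj P B) = frob A B.
Proof. by move=> Po; rewrite /frob conjT conjM // trace_conj. Qed.

Lemma comm_conj P A B : orthogonal_mx P ->
  comm (conj P A) (conj P B) = conj P (comm A B).
Proof. by move=> Po; rewrite /comm !conjM // /conj mulmxBr mulmxBl. Qed.

Lemma comm_diag (d : 'rV[R]_n) B i j :
  comm (diag_mx d) B i j = (d 0 i - d 0 j) * B i j.
Proof.
rewrite /comm mul_diag_mx mul_mx_diag !mxE; ring.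
Qed.

Lemma frob_comm_diag (d : 'rV[R]_n) B :
  frob (comm (diag_mx d) B) (comm (diag_mx d) B) =
  \sum_i \sum_j (d 0 i - d 0 j) ^+ 2 * B i j ^+ 2.
Proof.
rewrite frobE; apply: eq_bigr => i _; apply: eq_bigr => j _.
by rewrite comm_diag; ring.
Qed.

(** Read as a weighted graph on the indices, [B] has edges only between the centre [c] and the
    leaves in [K]. *)
Definition star_shape (c : 'I_n) (K : {set 'I_n}) B :=
  forall i j, B i j != 0 -> (i == c) && (j \in K) || (j == c) && (i \in K).

End Frobenius.

Section CommutatorRow.
Variables (R : rcfType) (n : nat) (T : finType) (I : {set T}).
Variables (A : 'M[R]_n) (B : T -> 'M[R]_n).
Hypotheses (symA : A^T = A) (symB : forall t, t \in I -> (B t)^T = B t).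
Hypothesis A1 : frob A A = 1.
Hypothesis oB : forall s t, s \in I -> t \in I -> frob (B s) (B t) = (s == t)%:R.

Let weight P i j := \sum_(t in I) (conj P (B t)) i j ^+ 2.

Let symC P t : t \in I -> (conj P (B t))^T = conj P (B t).
Proof. by move=> tI; rewrite conjT symB. Qed.

Let oC P s t : orthogonal_mx P -> s \in I -> t \in I ->
  frob (conj P (B s)) (conj P (B t)) = (s == t)%:R.
Proof. by move=> Po sI tI; rewrite frob_conj // oB. Qed.

Let weight_ge0 P i j : 0 <= weight P i j.
Proof. by apply: sumr_ge0 => t _; apply: sqr_ge0. Qed.

(** Bessel's inequality is applied to [E], of square norm 2, whose product with a symmetric matrix
    is twice the entry (i, j): four times the weight is at most 2. *)
Let weight_le P i j : orthogonal_mx P -> i != j -> weight P i j <= 2^-1.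
Proof.
move=> Po ij; pose E : 'M[R]_n := delta_mx i j + delta_mx j i.
have EE : frob E E = 2.
  rewrite {2}/E frobDr !frob_delta !mxE !eqxx (negPf ij).
  by rewrite [j == i]eq_sym (negPf ij) /= addr0 add0r.
have := bessel E (fun s t => @oC P s t Po).
have -> : \sum_(t in I) frob (conj P (B t)) E ^+ 2 = 4 * weight P i j.
  rewrite mulr_sumr; apply: eq_bigr => t tI; rewrite frobDr !frob_delta.
  have -> : conj P (B t) j i = conj P (B t) i j by rewrite -[in LHS]symC // mxE.
  by ring.
by rewrite EE; lra.
Qed.

Let sum_weight P : orthogonal_mx P -> \sum_i \sum_j weight P i j = #|I|%:R.
Proof.
move=> Po; rewrite /weight.
under eq_bigr do rewrite exchange_big /=.
rewrite exchange_big /= -sumr_const; apply: eq_bigr => t tI.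
have := oC Po tI tI; rewrite eqxx frobE => E; rewrite -[RHS]E.
by apply: eq_bigr => i _; apply: eq_bigr => j _; rewrite expr2.
Qed.

(** The weights add up to [#|I|], each matrix being of norm one. Taking this total out leaves the
    excesses [(d 0 i - d 0 j) ^+ 2 - 1], as in the star inequality. *)
Let sum_comm P (d : 'rV[R]_n) : orthogonal_mx P -> conj P A = diag_mx d ->
  \sum_(t in I) frob (comm A (B t)) (comm A (B t)) =
  #|I|%:R + \sum_i \sum_j ((d 0 i - d 0 j) ^+ 2 - 1) * weight P i j.
Proof.
move=> Po PA; rewrite -(sum_weight Po) -big_split /=.
have E t : frob (comm A (B t)) (comm A (B t)) =
    \sum_i \sum_j (d 0 i - d 0 j) ^+ 2 * conj P (B t) i j ^+ 2.
  by rewrite -(frob_conj _ _ Po) -comm_conj // PA frob_comm_diag.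
rewrite (eq_bigr _ (fun t _ => E t)) exchange_big /=; apply: eq_bigr => i _.
rewrite exchange_big /= -big_split /=; apply: eq_bigr => j _.
by rewrite -mulr_sumr -/(weight P i j); ring.
Qed.

Let diag_norm P (d : 'rV[R]_n) : orthogonal_mx P -> conj P A = diag_mx d ->
  \sum_i d 0 i ^+ 2 = 1.
Proof.
move=> Po PA; rewrite -A1 -(frob_conj _ _ Po) PA frobE; apply: eq_bigr => i _.
rewrite (bigD1 i) //= big1 ?addr0 => [|j /negPf ji].
  by rewrite mxE eqxx mulr1n expr2.
by rewrite mxE eq_sym ji mulr0n mulr0.
Qed.

Lemma comm_row_le :
  \sum_(t in I) frob (comm A (B t)) (comm A (B t)) <= #|I|%:R + 1.
Proof.
have [P [d [Po PA]]] := sym_spectral symA.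
rewrite (sum_comm Po PA) lerD2l; apply: star_weight_le => //.
- exact: diag_norm PA.
- by move=> i j; apply: weight_le.
Qed.

Lemma comm_row_eq :
  \sum_(t in I) frob (comm A (B t)) (comm A (B t)) = #|I|%:R + 1 ->
  exists P (d : 'rV[R]_n) c (K : {set 'I_n}),
    [/\ orthogonal_mx P, conj P A = diag_mx d, c \notin K & (0 < #|K|)%N] /\
    [/\ (forall j, j \in K -> d 0 j = - d 0 c / #|K|%:R),
        (forall j, j \notin K -> j != c -> d 0 j = 0) &
        forall t, t \in I -> star_shape c K (conj P (B t))].
Proof.
have [P [d [Po PA]]] := sym_spectral symA.
rewrite (sum_comm Po PA) => /addrI S1.
have [c [K [cK K0 dK dN st]]] := star_weight_eq (diag_norm Po PA)
  (weight_ge0 P) (fun i j => @weight_le P i j Po) S1.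
exists P, d, c, K; split; split=> // t tI i j Bij; apply: st.
rewrite gt_eqF // /weight (bigD1 t) //= ltr_pwDl ?exprn_even_gt0 //.
by apply: sumr_ge0 => s _; apply: sqr_ge0.
Qed.

End CommutatorRow.

(** The trace of the cube sums over closed walks of length three, and a star, being bipartite, has
    none. *)
Lemma star_shape_cube (R : realFieldType) n (c : 'I_n) (K : {set 'I_n})
    (B : 'M[R]_n) :
  c \notin K -> star_shape c K B -> \tr (B *m B *m B) = 0.
Proof.
move=> cK stB; rewrite /mxtrace big1 // => i _; rewrite mxE big1 // => k _.
rewrite mxE mulr_suml big1 // => l _; apply/eqP/negPn/negP.
rewrite !mulf_eq0 !negb_or => /andP[/andP[/stB il /stB lk] /stB ki].
have nK x : x \in K -> (x == c) = false by move=> xK; apply: contraTF xK => /eqP->.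
move: il lk ki => /orP[/andP[/eqP-> lK]|/andP[/eqP-> iK]].
  rewrite (nK l lK) lK /= andbT => /eqP ->.
  by rewrite eqxx (negPf cK).
rewrite eqxx (negPf cK) andbF orbF /= => kK.
by rewrite (nK _ kK) (nK _ iK).
Qed.

(** With k leaves the trace of the cube is [d 0 c ^+ 3] times 1 - 1 / k^2. *)
Lemma star_diag_cube (R : realFieldType) n (d : 'rV[R]_n) (c : 'I_n)
    (K : {set 'I_n}) :
  c \notin K -> (0 < #|K|)%N ->
  (forall j, j \in K -> d 0 j = - d 0 c / #|K|%:R) ->
  (forall j, j \notin K -> j != c -> d 0 j = 0) ->
  \tr (diag_mx d *m diag_mx d *m diag_mx d) = 0 -> d 0 c != 0 -> #|K| = 1%N.
Proof.
move=> cK K0 dK dN; rewrite /mxtrace.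
have E i : (diag_mx d *m diag_mx d *m diag_mx d) i i = d 0 i ^+ 3.
  by rewrite -mulmxA !mul_diag_mx !mxE eqxx mulr1n; ring.
rewrite (eq_bigr _ (fun i _ => E i)) (bigD1 c) //= (bigID (mem K)) /=.
rewrite [X in _ + (_ + X)]big1 => [|i /andP[ic iK]]; last first.
  by rewrite dN // expr0n.
rewrite (eq_bigl (mem K)) => [|i]; last first.
  by rewrite /= andbC; case: eqP => [->|]; rewrite ?(negPf cK) ?andbT.
have k0 : #|K|%:R != 0 :> R by rewrite pnatr_eq0 -lt0n.
rewrite (eq_bigr _ (fun i iK => congr1 (fun x => x ^+ 3) (dK i iK))).
rewrite sumr_const -mulr_natl addr0 => h dc0.
have /eqP : d 0 c ^+ 3 * (#|K|%:R ^+ 2 - 1) = 0.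
  by rewrite -[RHS](mulr0 (#|K|%:R ^+ 2)) -h; field.
rewrite mulf_eq0 expf_eq0 /= (negPf dc0) /= subr_eq0 sqrf_eq1.
move=> /orP[|/eqP k1]; first by rewrite pnatr_eq1 => /eqP.
by have := ler0n R #|K|; rewrite k1 oppr_ge0 ler10.
Qed.

(** Together with symmetry, supplied separately, this leaves the block (x, y; y, -x) in the rows and
    columns [c] and [j]. *)
Definition plane_shape (R : numDomainType) n (c j : 'I_n) (B : 'M[R]_n) :=
  (forall i k, B i k != 0 -> (i \in [:: c; j]) && (k \in [:: c; j])) /\
  B j j = - B c c.

Lemma commZ (R : realFieldType) n (x y : R) (A B : 'M[R]_n) :
  comm (x *: A) (y *: B) = (x * y) *: comm A B.
Proof.
rewrite /comm -!scalemxAl -!scalemxAr !scalerA scalerBr.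
by rewrite (mulrC y).
Qed.

Lemma comm_id (R : realFieldType) n (A : 'M[R]_n) : comm A A = 0.
Proof. exact: subrr. Qed.

Lemma plane_shapeZ (R : numDomainType) n (c j : 'I_n) x (B : 'M[R]_n) :
  plane_shape c j B -> plane_shape c j (x *: B).
Proof.
move=> [B1 B2]; split; last by rewrite !mxE B2 mulrN.
by move=> i k; rewrite mxE mulf_eq0 negb_or => /andP[_ /B1].
Qed.

(* With B t = r t *: U t for unit matrices U t, the commutator norms of the U t *)
(* satisfy the row bounds of layer_cake with equality, so comm_row_eq makes     *)
(* each U t a star in an eigenbasis of any other U u. A star B has              *)
(* tr (B ^+ 3) = 0, while U u has eigenvalues d c once and - d c / #|K| with    *)
(* multiplicity #|K|: hence #|K| = 1 and the star is a single edge.             *)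
Theorem ddvv_equality (R : rcfType) n (T : finType) (B : T -> 'M[R]_n) :
  (forall t, (B t)^T = B t) ->
  (forall s t, s != t -> frob (B s) (B t) = 0) ->
  \sum_s \sum_t frob (comm (B s) (B t)) (comm (B s) (B t)) =
    (\sum_t frob (B t) (B t)) ^+ 2 ->
  (forall t, B t = 0) \/
  exists P c j, [/\ orthogonal_mx P, c != j &
    forall t, plane_shape c j (conj P (B t))].
Proof.
move=> symB oB eqB.
pose a t := frob (B t) (B t); pose r t := Num.sqrt (a t).
pose U t := (r t)^-1 *: B t.
pose p s t := frob (comm (U s) (U t)) (comm (U s) (U t)).
have a0 t : 0 <= a t by apply: frob_ge0.
have r2 t : r t ^+ 2 = a t by rewrite sqr_sqrtr.
(* If [r t = 0] then [B t = 0], and the convention [0^-1 = 0] makes [U t] zero as well. *)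
have BU t : B t = r t *: U t.
  rewrite /U scalerA; have [rt0|rt0] := eqVneq (r t) 0.
    rewrite rt0 mul0r scale0r; apply: frob_eq0.
    by rewrite -/(a t) -r2 rt0 expr0n.
  by rewrite mulfV // scale1r.
have symU t : (U t)^T = U t by rewrite /U linearZ /= symB.
have pC s t : p s t = p t s.
  rewrite /p; have -> : comm (U t) (U s) = (-1) *: comm (U s) (U t).
    by rewrite scaleN1r /comm opprB.
  by rewrite frobZl frobZr mulrA mulrNN !mul1r.
pose I := positive_part a.
have UU s t : s \in I -> t \in I -> frob (U s) (U t) = (s == t)%:R.
  rewrite !inE => s0 t0; rewrite frobZl frobZr.
  have [->|st] := eqVneq s t; last by rewrite oB // !mulr0.
  by rewrite mulrA -expr2 exprVn r2 mulVf // gt_eqF.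
(* The diagonal term vanishes, so the row of [s] runs over one matrix fewer: the bound
   [#|J :\ s| + 1] of [comm_row_le] is then exactly [#|J|]. *)
have rowE (J : {set T}) s : s \in J ->
    \sum_(t in J) p s t = \sum_(t in J :\ s) p s t.
  move=> sJ; rewrite (bigD1 s) //= {1}/p comm_id.
  rewrite (_ : frob 0 0 = 0) ?add0r; last first.
    by rewrite /frob mul0mx mxtrace0.
  by apply: eq_bigl => t; rewrite !inE andbC.
have cardE (J : {set T}) s : s \in J -> #|J|%:R = #|J :\ s|%:R + 1 :> R.
  by move=> sJ; rewrite (cardsD1 s) sJ addnC natrD.
have hp (J : {set T}) : J \subset I -> forall s, s \in J ->
    \sum_(t in J) p s t <= #|J|%:R.
  move=> JI s sJ; rewrite rowE // (cardE _ _ sJ); apply: comm_row_le => //.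
    by rewrite UU ?eqxx // (fintype.subsetP JI).
  move=> u v; rewrite !inE => /andP[_ uJ] /andP[_ vJ].
  by apply: UU; apply: (fintype.subsetP JI).
have sumE : \sum_s \sum_t a s * a t * p s t = (\sum_s a s) ^+ 2.
  rewrite -eqB; apply: eq_bigr => s _; apply: eq_bigr => t _.
  have -> : comm (B s) (B t) = (r s * r t) *: comm (U s) (U t).
    by rewrite -commZ -!BU.
  by rewrite frobZl frobZr -/(p s t) -!r2; ring.
have [_ /(_ sumE) eqI] := layer_cake pC a0 hp.
rewrite -/I in eqI.
have [I0|[s sI]] := set_0Vmem I.
  left=> t; apply: frob_eq0; apply: le_anti; rewrite -/(a t) a0 andbT leNgt.
  by move/setP/(_ t): I0; rewrite !inE => ->.
right.
have eqR u : u \in I -> exists P (d : 'rV[R]_n) c (K : {set 'I_n}),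
    [/\ orthogonal_mx P, conj P (U u) = diag_mx d, c \notin K & (0 < #|K|)%N] /\
    [/\ (forall j, j \in K -> d 0 j = - d 0 c / #|K|%:R),
        (forall j, j \notin K -> j != c -> d 0 j = 0) &
        forall t, t \in I :\ u -> star_shape c K (conj P (U t))].
  move=> uI; apply: comm_row_eq => //; first by rewrite UU ?eqxx.
    by move=> v w; rewrite !inE => /andP[_ vJ] /andP[_ wJ]; apply: UU; rewrite inE.
  by rewrite -(cardE _ _ uI) -(eqI u uI) (rowE _ _ uI).
have [P0 [d0 [c0 [K0 [[P0o _ cK0 _] [_ _ st0]]]]]] := eqR s sI.
(* If [s] were alone in the support, its row would sum to 0 instead of 1. *)
have [u uIs] : exists u, u \in I :\ s.
  apply/set0Pn; apply/eqP => Is0; have := eqI s sI.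
  by rewrite rowE // (cardE _ _ sI) Is0 big_set0 cards0 add0r => /eqP; rewrite eq_sym oner_eq0.
have uI : u \in I by move: uIs; rewrite inE => /andP[].
have [P [d [c [K [[Po Pd cK K_gt0] [dK dN st]]]]]] := eqR u uI.
have dc0 : d 0 c != 0.
  apply/eqP => dc0; have := UU u u uI uI; rewrite eqxx -(frob_conj _ _ Po) Pd.
  suff -> : d = 0 by rewrite linear0 /frob mul0mx mxtrace0 => /eqP; rewrite eq_sym oner_eq0.
  apply/rowP => i; rewrite mxE; have [/dK->|iK] := boolP (i \in K).
    by rewrite dc0 oppr0 mul0r.
  by have [->|ic] := eqVneq i c; [|apply: dN].
have trU : \tr (U u *m U u *m U u) = 0.
  by rewrite -(trace_conj _ P0o) -!conjM //; apply: star_shape_cube cK0 (st0 u uIs).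
have K1 : #|K| = 1%N.
  apply: (star_diag_cube cK K_gt0 dK dN) dc0.
  by rewrite -Pd !conjM // trace_conj.
have /cards1P [j Kj] : #|K| == 1%N by rewrite K1.
exists P, c, j; split=> //.
  by apply: contraNneq cK => ->; rewrite Kj inE.
move=> t; rewrite (BU t) /conj -scalemxAr -scalemxAl -/(conj P (U t)).
apply: plane_shapeZ.
(* In the eigenbasis of [U u] all matrices share the plane of [c] and [j]: [U u] is its diagonal
   traceless part, the other matrices of the support are off-diagonal there, and those outside the
   support vanish. *)
have [->|tu] := eqVneq t u.
  rewrite Pd; split; last by rewrite !mxE !eqxx !mulr1n dK ?K1 ?divr1 // Kj inE.
  move=> i k; rewrite mxE; have [<-|_] := eqVneq i k; last first.
    by rewrite mulr0n eqxx.
  rewrite mulr1n andbb !inE => dk0; apply: contraNT dk0; rewrite negb_or.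
  by move=> /andP[kc kj]; rewrite dN // Kj inE.
have [tI|tI] := boolP (t \in I); last first.
  have -> : conj P (U t) = 0.
    have at0 : a t = 0 by apply/eqP; rewrite eq_le a0 andbT leNgt; move: tI; rewrite inE.
    by rewrite /U (frob_eq0 at0) scaler0 /conj mulmx0 mul0mx.
  by split=> [i k|]; rewrite !mxE ?eqxx ?oppr0.
have stt : star_shape c K (conj P (U t)) by apply: st; rewrite inE tI andbT inE.
have cj : c != j by apply: contraNneq cK => ->; rewrite Kj inE.
have diag0 i : conj P (U t) i i = 0.
  apply/eqP/negPn/negP => /stt; rewrite orbb Kj inE => /andP[/eqP-> /eqP cj'].
  by rewrite cj' eqxx in cj.
split; last by rewrite !diag0 oppr0.
move=> i k /stt; rewrite Kj !inE.
by move=> /orP[] /andP[-> ->]; rewrite ?orbT.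
Qed.

(** * Curvature tensors of Wintgen type *)

Section Inner.
Variables (R : realType) (n : nat) (g : 'M[R]_n).
Implicit Types u v w : 'rV[R]_n.

Lemma innerDl u v w : inner g (u + v) w = inner g u w + inner g v w.
Proof. by rewrite /inner !mulmxDl mxE. Qed.

Lemma innerZl c u v : inner g (c *: u) v = c * inner g u v.
Proof. by rewrite /inner -!scalemxAl mxE. Qed.

Lemma innerDr u v w : inner g w (u + v) = inner g w u + inner g w v.
Proof. by rewrite /inner linearD mulmxDr mxE. Qed.

Lemma innerZr c u v : inner g u (c *: v) = c * inner g u v.
Proof. by rewrite /inner linearZ /= -scalemxAr mxE. Qed.

Lemma innerNl u v : inner g (- u) v = - inner g u v.
Proof. by rewrite -scaleN1r innerZl mulN1r. Qed.

Lemma innerNr u v : inner g u (- v) = - inner g u v.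
Proof. by rewrite -scaleN1r innerZr mulN1r. Qed.

Lemma inner0l v : inner g 0 v = 0.
Proof. by rewrite -(scale0r v) innerZl mul0r. Qed.

Lemma inner0r v : inner g v 0 = 0.
Proof. by rewrite -(scale0r v) innerZr mul0r. Qed.

Definition innerE := (innerDl, innerDr, innerZl, innerZr, innerNl, innerNr,
  inner0l, inner0r).

Lemma inner_suml (I : finType) (F : I -> 'rV[R]_n) v :
  inner g (\sum_i F i) v = \sum_i inner g (F i) v.
Proof.
by elim/big_rec2: _ => [|i x y _ <-]; rewrite ?inner0l ?innerDl.
Qed.

Lemma inner_sumr (I : finType) (F : I -> 'rV[R]_n) v :
  inner g v (\sum_i F i) = \sum_i inner g v (F i).
Proof.
by elim/big_rec2: _ => [|i x y _ <-]; rewrite ?inner0r ?innerDr.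
Qed.

Lemma innerC u v : g^T = g -> inner g u v = inner g v u.
Proof.
move=> gs; have E : (u *m g *m v^T)^T = v *m g *m u^T.
  by rewrite !trmx_mul trmxK gs mulmxA.
by have /matrixP/(_ 0 0) := E; rewrite [LHS]mxE.
Qed.

Lemma inner_nondeg u v : posdef g ->
  (forall w, inner g u w = inner g v w) -> u = v.
Proof.
move=> [_ gp] uv; apply/eqP; rewrite -subr_eq0; apply/negPn/negP => /gp.
by rewrite -/(inner _ _ _) innerDl innerNl uv subrr ltxx.
Qed.

Lemma inner_sharp (B : 'rV[R]_n -> 'rV[R]_n -> R) u v : g \in unitmx ->
  linear (B u : 'rV[R]_n -> R^o) -> inner g (sharp g B u) v = B u v.
Proof.
move=> gu linB; rewrite /inner /sharp mulmxKV // mxE.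
pose f : {linear 'rV[R]_n -> R^o} := HB.pack (B u : 'rV[R]_n -> R^o)
  (GRing.isLinear.Build _ _ _ _ _ linB).
rewrite [in RHS](row_sum_delta v) -[RHS]/(f _) linear_sum.
by apply: eq_bigr => j _; rewrite linearZ /= !mxE mulrC.
Qed.

(** Both traces needed below, for the Ricci tensor and for the scalar curvature, are of a multiple
    of the identity plus at most four operators of rank one. *)
Lemma trace_rank4 (c : R) (v1 v2 v3 v4 e1 e2 e3 e4 : 'rV[R]_n) :
  trace (fun z => c *: z + inner g v1 z *: e1 + inner g v2 z *: e2
                  + inner g v3 z *: e3 + inner g v4 z *: e4) =
  n%:R * c + inner g v1 e1 + inner g v2 e2 + inner g v3 e3 + inner g v4 e4.
Proof.
have E (v e : 'rV[R]_n) :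
    \sum_i (inner g v (delta_mx 0 i) *: e) 0 i = inner g v e.
  rewrite [in RHS](row_sum_delta e) inner_sumr; apply: eq_bigr => i _.
  by rewrite mxE innerZr mulrC.
rewrite /trace /mxtrace -!E.
have -> : n%:R * c = \sum_(i < n) (c *: (delta_mx 0 i : 'rV[R]_n)) 0 i.
  rewrite -[n in LHS]card_ord mulr_natl -sumr_const; apply: eq_bigr => i _.
  by rewrite !mxE !eqxx mulr1.
rewrite -!big_split /=; apply: eq_bigr => i _.
by rewrite !mxE.
Qed.

End Inner.

Section PlaneCurvature.
Variables (R : realType) (n : nat) (g : 'M[R]_n).
Local Notation V := 'rV[R]_n.
Variable calR : V -> V -> V -> V.
Variables (p q : V) (K xi eta omega : R).
Hypotheses (gp : posdef g) (n4 : (4 <= n)%N).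
Hypotheses (pp : inner g p p = 1) (qq : inner g q q = 1) (pq : inner g p q = 0).
Local Notation "<< u , v >>" := (inner g u v).

(** The general traceless symmetric form on the plane of [p] and [q], with matrix (xi, eta; eta,
    -xi), extended by zero to the orthogonal complement. *)
Definition plane_form (xi eta : R) (u v : V) : R :=
  xi * (<< p, u >> * << p, v >> - << q, u >> * << q, v >>)
  + eta * (<< p, u >> * << q, v >> + << q, u >> * << p, v >>).

Local Notation D := (plane_form xi eta).

Hypothesis calRE : forall u v w z, << calR u v w, z >> =
  K * (<< v, w >> * << u, z >> - << u, w >> * << v, z >>)
  + (<< v, w >> * D u z + D v w * << u, z >>
     - << u, w >> * D v z - D u w * << v, z >>)
  - omega * (<< p, u >> * << q, v >> - << q, u >> * << p, v >>)
          * (<< p, z >> * << q, w >> - << q, z >> * << p, w >>).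

Let gsym : g^T = g. Proof. by case: gp. Qed.
Let C := fun u v => innerC u v gsym.
Let qp : << q, p >> = 0. Proof. by rewrite C. Qed.

Let n2 : n%:R - 2 != 0 :> R.
Proof. by rewrite subr_eq0 eqr_nat; case: n n4 => [|[|[]]]. Qed.
Let n1 : n%:R - 1 != 0 :> R.
Proof. by rewrite subr_eq0 pnatr_eq1; case: n n4 => [|[|[]]]. Qed.

Lemma plane_ricciE x y : ricci calR x y =
  K * (n%:R - 1) * << x, y >> + (n%:R - 2) * D x y
  - omega * (<< p, x >> * << p, y >> + << q, x >> * << q, y >>).
Proof.
(* [p'] and [q'] represent the forms [D p] and [D q], hence [Dx] and [Dy] represent [D x] and [D y].
   The vector [w] is the projection of [y] on the plane, turned by a right angle; it carries the
   part in [omega]. *)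
pose p' := xi *: p + eta *: q; pose q' := eta *: p - xi *: q.
pose Dy := << p, y >> *: p' + << q, y >> *: q'.
pose Dx := << p, x >> *: p' + << q, x >> *: q'.
pose w := << q, y >> *: p - << p, y >> *: q.
pose f z := (K * << x, y >> + D x y) *: z + << y, z >> *: (- (K *: x + Dx))
  + << Dy, z >> *: (- x) + << p, z >> *: (<< x, y >> *: p' - (omega * << q, x >>) *: w)
  + << q, z >> *: (<< x, y >> *: q' + (omega * << p, x >>) *: w).
rewrite /ricci (_ : (fun z => calR z x y) = f); last first.
  apply/funext => z; apply: (inner_nondeg gp) => t.
  rewrite calRE /f /Dy /Dx /w /p' /q' !innerE /plane_form.
  by rewrite (C z y); ring.
rewrite /f trace_rank4 /Dy /Dx /w /p' /q' !innerE pp qq pq qp /plane_form.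
rewrite (C y x) (C y p) (C y q); ring.
Qed.

Let S x := (K * (n%:R - 1)) *: x
  + << p, x >> *: ((n%:R - 2) *: (xi *: p + eta *: q) - omega *: p)
  + << q, x >> *: ((n%:R - 2) *: (eta *: p - xi *: q) - omega *: q).

Lemma plane_ricci_opE x : ricci_op g calR x = S x.
Proof.
apply: (inner_nondeg gp) => z; rewrite inner_sharp; last 2 first.
- exact: posdef_unit.
- move=> c u v; rewrite !plane_ricciE /plane_form !innerE /GRing.scale /=; ring.
by rewrite plane_ricciE /S !innerE /plane_form; ring.
Qed.

Lemma plane_scalarE :
  scalar_curvature g calR = K * (n%:R - 1) * n%:R - 2 * omega.
Proof.
rewrite /scalar_curvature (_ : ricci_op g calR = fun z => (K * (n%:R - 1)) *: z
  + << p, z >> *: ((n%:R - 2) *: (xi *: p + eta *: q) - omega *: p)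
  + << q, z >> *: ((n%:R - 2) *: (eta *: p - xi *: q) - omega *: q)
  + << 0, z >> *: 0 + << 0, z >> *: 0).
  by rewrite trace_rank4 !innerE pp qq pq qp; ring.
by apply/funext => x; rewrite plane_ricci_opE /S !inner0l !scale0r !addr0.
Qed.

(** [K], [xi] and [eta] drop out because their parts of the curvature are Kulkarni-Nomizu products
    of the metric with a symmetric form, which the Weyl projection annihilates. *)
Lemma plane_weylE x y z t :
  << weyl_op g calR x y z, t >> =
  - omega * (<< p, x >> * << q, y >> - << q, x >> * << p, y >>)
          * (<< p, t >> * << q, z >> - << q, t >> * << p, z >>)
  + omega / (n%:R - 2) *
    ((<< p, y >> * << p, z >> + << q, y >> * << q, z >>) * << x, t >>
     - << x, z >> * (<< p, y >> * << p, t >> + << q, y >> * << q, t >>)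
     + << y, z >> * (<< p, x >> * << p, t >> + << q, x >> * << q, t >>)
     - (<< p, x >> * << p, z >> + << q, x >> * << q, z >>) * << y, t >>
     - 2 / (n%:R - 1) * (<< y, z >> * << x, t >> - << x, z >> * << y, t >>)).
Proof.
rewrite /weyl_op /wedge_op !plane_ricci_opE plane_scalarE /S !innerE calRE.
rewrite /plane_form; field.
by rewrite n1 n2.
Qed.

(* The dependence is tested on (e, f, f, p, p, e), (e, f, f, q, q, e),         *)
(* (e, q, q, p, p, e) and (e, p, p, q, q, e): as the Weyl operator acts on      *)
(* p, e and q, e as a multiple l of the wedge operator, the first two give      *)
(* b = 0 and the last two a = 0.                                               *)
Lemma plane_curvature_independent e f : omega != 0 ->
  << e, e >> = 1 -> << f, f >> = 1 -> << e, f >> = 0 ->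
  << p, e >> = 0 -> << q, e >> = 0 -> << p, f >> = 0 -> << q, f >> = 0 ->
  ~ linearly_dependent (C_dot_R g calR) (Q_g_gRicc g calR).
Proof.
move=> w0 ee ff ef pe qe pf qf [a [b [ab0 dep]]].
have [ep eq fp fq fe] : [/\ << e, p >> = 0, << e, q >> = 0, << f, p >> = 0,
    << f, q >> = 0 & << f, e >> = 0] by split; rewrite C.
have nz : n%:R - 3 != 0 :> R.
  by rewrite subr_eq0 eqr_nat; case: n n4 => [|[|[|[]]]].
(* This is [omega / (n%:R - 2)] times 1 - 2 / (n - 1), read off from [plane_weylE]; it is nonzero
   because n > 3. *)
pose l := omega * (n%:R - 3) / ((n%:R - 1) * (n%:R - 2)).
have W u z : u = p \/ u = q -> weyl_op g calR u e z =
    l *: wedge_op (inner g) u e z.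
  move=> uE; apply: (inner_nondeg gp) => t; rewrite plane_weylE /wedge_op !innerE.
  by rewrite pe qe; case: uE => ->; rewrite ?(pp, qq, pq, qp) /l; field; rewrite n1 n2.
have Wp z := W p z (or_introl erefl); have Wq z := W q z (or_intror erefl).
pose N := (ee, ff, pp, qq, pq, qp, ef, fe, pe, ep, qe, eq, pf, fp, qf, fq).
have wE : [/\ wedge_op (inner g) p e e = p, wedge_op (inner g) p e f = 0,
    wedge_op (inner g) p e p = - e & wedge_op (inner g) p e q = 0].
  by split; rewrite /wedge_op !N ?scale1r ?scale0r ?subr0 ?sub0r.
have wE' : [/\ wedge_op (inner g) q e e = q, wedge_op (inner g) q e f = 0,
    wedge_op (inner g) q e q = - e & wedge_op (inner g) q e p = 0].
  by split; rewrite /wedge_op !N ?scale1r ?scale0r ?subr0 ?sub0r.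
have [pe_e pe_f pe_p pe_q] := wE; have [qe_e qe_f qe_q qe_p] := wE'.
have h1 : a * (- l * xi) - b * ((n%:R - 2) * xi - omega) = 0.
  rewrite -[RHS](dep e f f p p e) /C_dot_R /Q_g_gRicc /derivation_action /lower.
  rewrite /kulkarni_nomizu !Wp pe_e pe_f pe_p !plane_ricciE !calRE /plane_form.
  rewrite !innerE !N; ring.
have h2 : a * (l * xi) - b * (- (n%:R - 2) * xi - omega) = 0.
  rewrite -[RHS](dep e f f q q e) /C_dot_R /Q_g_gRicc /derivation_action /lower.
  rewrite /kulkarni_nomizu !Wq qe_e qe_f qe_q !plane_ricciE !calRE /plane_form.
  rewrite !innerE !N; ring.
(* Adding [h1] and [h2] cancels all terms in [xi]; so does adding [h3] and [h4] below. *)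
have b0 : b = 0.
  have : 2 * omega * b = 0 by lra.
  by move=> /eqP; rewrite !mulf_eq0 pnatr_eq0 (negPf w0) => /eqP.
have h3 : a * (- l * (xi - omega)) = 0.
  rewrite -[RHS](dep e q q p p e) /C_dot_R b0 /derivation_action /lower.
  rewrite !Wp pe_e pe_q pe_p !calRE /plane_form.
  rewrite !innerE !N; ring.
have h4 : a * (- l * (- xi - omega)) = 0.
  rewrite -[RHS](dep e p p q q e) /C_dot_R b0 /derivation_action /lower.
  rewrite !Wq qe_e qe_p qe_q !calRE /plane_form.
  rewrite !innerE !N; ring.
have : a * l * (2 * omega) = 0 by lra.
move=> /eqP; rewrite !mulf_eq0 !invr_eq0 !mulf_eq0 pnatr_eq0 (negPf w0) (negPf nz).
rewrite (negPf n1) (negPf n2) /= !orbF => a0.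
by move: ab0; rewrite a0 b0 eqxx.
Qed.

End PlaneCurvature.

(** * The Wintgen equality at a point *)

Lemma sum_upper (R : pzRingType) n (f : 'I_n -> 'I_n -> R) :
  (forall i j, f i j = f j i) ->
  \sum_i \sum_j f i j =
  \sum_i f i i + 2 * \sum_(i < n) \sum_(j < n | (i < j)%N) f i j.
Proof.
move=> fC; have E i : \sum_j f i j = f i i +
    (\sum_(j < n | (i < j)%N) f i j + \sum_(j < n | (j < i)%N) f i j).
  rewrite (bigD1 i) //= (bigID (fun j : 'I_n => (i < j)%N)) /=; congr (_ + (_ + _)).
    apply: eq_bigl => j; rewrite andbC; case: ltngtP => //= ij.
    by apply/eqP => ji; rewrite ji ltnn in ij.
  apply: eq_bigl => j; rewrite -leqNgt ltn_neqAle; congr (_ && _).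
rewrite (eq_bigr _ (fun i _ => E i)) !big_split /=; congr (_ + _).
rewrite mulr_natl mulr2n; congr (_ + _).
rewrite (exchange_big_dep xpredT) //=; apply: eq_bigr => i _.
by apply: eq_bigr => j _.
Qed.

Lemma exchange_big22 (R : nmodType) (I J A B : finType) (Q : I -> pred J)
    (S : A -> pred B) (f : I -> J -> A -> B -> R) :
  \sum_i \sum_(j | Q i j) \sum_a \sum_(b | S a b) f i j a b =
  \sum_a \sum_(b | S a b) \sum_i \sum_(j | Q i j) f i j a b.
Proof.
under eq_bigr do rewrite exchange_big /=.
rewrite exchange_big /=; apply: eq_bigr => a _.
under eq_bigr do rewrite exchange_big /=.
by rewrite exchange_big.
Qed.

(** One factor 2 comes from exchanging [a] and [b], the other from exchanging [i] and [j], since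
    commutators of symmetric matrices are skew; both diagonals vanish. *)
Lemma sum_comm_upper (R : realFieldType) n m (B : 'I_m -> 'M[R]_n) :
  (forall a, (B a)^T = B a) ->
  \sum_a \sum_b frob (comm (B a) (B b)) (comm (B a) (B b)) =
  4 * \sum_(i < n) \sum_(j < n | (i < j)%N)
      \sum_(a < m) \sum_(b < m | (a < b)%N) comm (B b) (B a) i j ^+ 2.
Proof.
move=> sB; have cT a b : (comm (B a) (B b))^T = - comm (B a) (B b).
  by rewrite /comm linearB /= !trmx_mul !sB opprB.
have cTe a b i j : comm (B a) (B b) i j = - comm (B a) (B b) j i.
  by have /matrixP/(_ j i) := cT a b; rewrite [LHS]mxE [RHS]mxE.
have frobC' a b : frob (comm (B a) (B b)) (comm (B a) (B b)) =
    frob (comm (B b) (B a)) (comm (B b) (B a)).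
  have -> : comm (B a) (B b) = - comm (B b) (B a) by rewrite /comm opprB.
  by rewrite -scaleN1r frobZl frobZr mulrA mulrNN !mul1r.
rewrite exchange_big22 sum_upper //.
have -> : \sum_a frob (comm (B a) (B a)) (comm (B a) (B a)) = 0.
  by apply: big1 => a _; rewrite comm_id /frob mul0mx mxtrace0.
have -> : 4 = 2 * 2 :> R by ring.
rewrite add0r -mulrA; congr (_ * _).
rewrite mulr_sumr; apply: eq_bigr => a _; rewrite mulr_sumr.
apply: eq_bigr => b _; rewrite frobC' frobE sum_upper; last first.
  by move=> i j; rewrite cTe mulrNN.
have -> : \sum_i comm (B b) (B a) i i * comm (B b) (B a) i i = 0.
  apply: big1 => i _; have /eqP := cTe b a i i.
  by rewrite -subr_eq0 opprK -mulr2n mulrn_eq0 /= => /eqP ->; rewrite mul0r.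
by rewrite add0r.
Qed.

Lemma inner_row (R : realType) n r s (g : 'M[R]_n) (P : 'M[R]_(r, n))
    (Q : 'M[R]_(s, n)) i j :
  (P *m g *m Q^T) i j = inner g (row i P) (row j Q).
Proof.
rewrite /inner -row_mul [LHS]mxE [RHS]mxE; apply: eq_bigr => k _.
by rewrite ![_^T _ _]mxE [row _ _ _ _]mxE [row _ _ _ _]mxE.
Qed.

Lemma inner_mulmx (R : realType) n s (g : 'M[R]_n) u (Q : 'M[R]_(s, n)) j :
  (u *m g *m Q^T) 0 j = inner g u (row j Q).
Proof. by rewrite inner_row row_id. Qed.

Lemma orthonormal_rowP (R : realType) n r (g : 'M[R]_n) (P : 'M[R]_(r, n)) :
  orthonormal g (fun i => row i P) <-> P *m g *m P^T = 1%:M.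
Proof.
split=> [Po|Po i j]; last by rewrite -inner_row Po mxE.
by apply/matrixP => i j; rewrite inner_row Po mxE.
Qed.

Lemma plane_shape_sum (R : numDomainType) n (c j : 'I_n) (B : 'M[R]_n)
    (u v : 'I_n -> R) : c != j -> B^T = B -> plane_shape c j B ->
  \sum_i \sum_l u i * v l * B i l =
  B c c * (u c * v c - u j * v j) + B c j * (u c * v j + u j * v c).
Proof.
move=> cj sB [B1 B2].
have B0 i l : (i \notin [:: c; j]) || (l \notin [:: c; j]) -> B i l = 0.
  by move=> il; apply/eqP/negPn/negP => /B1; rewrite -[_ && _]negbK negb_and il.
have Bjc : B j c = B c j by rewrite -[in LHS]sB mxE.
have jc : j != c by rewrite eq_sym.
have S (F : 'I_n -> R) : (forall i, i \notin [:: c; j] -> F i = 0) ->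
    \sum_i F i = F c + F j.
  move=> F0; rewrite (bigD1 c) //= (bigD1 j) //= big1 ?addr0 // => i /andP[ic ij].
  by rewrite F0 // !inE negb_or ic ij.
rewrite S => [|i ic]; last by rewrite big1 // => l _; rewrite B0 ?ic ?mulr0.
rewrite !S; try by move=> l lc; rewrite B0 ?lc ?orbT ?mulr0.
by rewrite B2 Bjc; ring.
Qed.

Section Frames.
Variables (R : realType) (n : nat) (g : 'M[R]_n).
Hypothesis gp : posdef g.
Let gsym : g^T = g. Proof. by case: gp. Qed.

Lemma frame_exists : exists E : 'I_n -> 'rV[R]_n, orthonormal g E.
Proof.
have [P PP] := posdef_frame gp; exists (fun i => row i P).
exact/orthonormal_rowP.
Qed.

Section Frame.
Variable E : 'I_n -> 'rV[R]_n.
Hypothesis oE : orthonormal g E.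

Lemma frame_sum v : v = \sum_i inner g (E i) v *: E i.
Proof.
pose P := \matrix_i E i.
have EP i : E i = row i P by rewrite rowK.
have : P *m g *m P^T = 1%:M.
  by apply/orthonormal_rowP => i j; rewrite -!EP.
move=> /mulmx1C /(congr1 trmx); rewrite trmx1 !trmx_mul trmxK gsym => PP.
rewrite -[LHS]mulmx1 -PP !mulmxA mulmx_sum_row; apply: eq_bigr => i _.
rewrite EP; congr (_ *: _).
by rewrite inner_row -EP row_id innerC.
Qed.

Lemma frame_rotate (P : 'M[R]_n) : orthogonal_mx P ->
  orthonormal g (fun i => \sum_k P i k *: E k).
Proof.
move=> Po i j; rewrite inner_suml.
have -> : (i == j)%:R = (P *m P^T) i j by rewrite Po mxE.
rewrite mxE; apply: eq_bigr => k _; rewrite innerZl inner_sumr.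
rewrite (bigD1 k) //= innerZr oE eqxx mulr1 big1 ?addr0 ?mxE // => l /negPf lk.
by rewrite innerZr oE eq_sym lk mulr0.
Qed.

End Frame.
End Frames.

(** * The second fundamental form at a single point *)

Section SecondForm.
Variables (R : realType) (n m : nat) (k : R).
Variables (g : 'M[R]_n) (g' : 'M[R]_(n + m)) (J : 'M[R]_(n, n + m)).
Local Notation V := 'rV[R]_n.
Local Notation V' := 'rV[R]_(n + m).
Variables (h : V -> V -> V') (calR : V -> V -> V -> V).
Local Notation "<< u , v >>" := (inner g u v).
Local Notation "<< u , v >>'" := (inner g' u v).
Hypotheses (gp : posdef g) (gp' : posdef g') (gJ : J *m g' *m J^T = g).
Hypothesis hC : forall u v, h u v = h v u.
Hypothesis h_lin : forall u, linear (h u).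
Hypothesis h_normal : forall u v w, << h u v, w *m J >>' = 0.
Hypothesis gauss : forall u v w z, << calR u v w, z >> =
  k * (<< v, w >> * << u, z >> - << u, w >> * << v, z >>)
  + << h v w, h u z >>' - << h u w, h v z >>'.

Let gsym : g^T = g. Proof. by case: gp. Qed.
Let gsym' : g'^T = g'. Proof. by case: gp'. Qed.

Lemma immersion_row_free : row_free J.
Proof.
have gu := posdef_unit gp; rewrite -row_leq_rank.
have : (\rank g <= \rank J)%N.
  rewrite -gJ -mulmxA; exact: mxrankM_maxl.
by move: gu; rewrite -row_full_unit => /eqP ->.
Qed.

Section NormalFrame.
Variable X : 'M[R]_(m, n + m).
Hypotheses (XJ : X *m g' *m J^T = 0) (XX : X *m g' *m X^T = 1%:M).

Lemma adapted_frame_unit : col_mx J X \in unitmx.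
Proof.
rewrite -row_free_unit -kermx_eq0; apply/eqP/row_matrixP => i; rewrite row0.
set c := row i _; have : c *m col_mx J X = 0 by rewrite -row_mul mulmx_ker row0.
rewrite -[c]hsubmxK mul_row_col => c0.
have cr : rsubmx c = 0.
  have := congr1 (fun M => M *m (g' *m X^T)) c0.
  rewrite mul0mx mulmxDl -!mulmxA (mulmxA X) XX mulmx1.
  have -> : J *m (g' *m X^T) = 0.
    by apply: trmx_inj; rewrite !trmx_mul trmxK gsym' trmx0.
  by rewrite mulmx0 add0r.
move: c0; rewrite cr mul0mx addr0 => cl.
have cl0 : lsubmx c = 0.
  by apply: (row_free_inj immersion_row_free); rewrite cl mul0mx.
by rewrite cl0 row_mx0.
Qed.

Lemma frame_normal a w : << row a X, w *m J >>' = 0.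
Proof.
by rewrite /inner trmx_mul mulmxA -!row_mul XJ mul0mx row0 mxE.
Qed.

Lemma frame_orthonormal : orthonormal g' (fun a => row a X).
Proof. exact/orthonormal_rowP. Qed.

(** The difference of the two sides is orthogonal to the rows of [J] and of [X], which together form
    a basis. *)
Lemma normal_sum (nu : V') : (forall w, << nu, w *m J >>' = 0) ->
  nu = \sum_a << row a X, nu >>' *: row a X.
Proof.
move=> nuJ; apply/eqP; rewrite -subr_eq0; set d := nu - _.
have dJ : d *m g' *m J^T = 0.
  apply/rowP => j; rewrite inner_mulmx mxE rowE /d !innerE nuJ inner_suml.
  rewrite big1 ?subr0 // => a _; by rewrite innerZl frame_normal mulr0.
have dX : d *m g' *m X^T = 0.
  apply/rowP => j; rewrite inner_mulmx mxE /d !innerE inner_suml.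
  rewrite (bigD1 j) //= big1 ?addr0 => [|a /negPf aj].
    by rewrite innerZl frame_orthonormal eqxx mulr1 innerC // subrr.
  by rewrite innerZl frame_orthonormal aj mulr0.
suff : d *m g' *m (col_mx J X)^T = 0.
  move=> d0; apply/eqP.
  have u : (col_mx J X)^T \in unitmx by rewrite unitmx_tr adapted_frame_unit.
  by rewrite -(mulmxK (posdef_unit gp') d) -(mulmxK u (d *m g')) d0 !mul0mx.
by rewrite tr_col_mx mul_mx_row dJ dX row_mx0.
Qed.

Lemma normal_parseval (nu mu : V') : (forall w, << nu, w *m J >>' = 0) ->
  << nu, mu >>' = \sum_a << row a X, nu >>' * << row a X, mu >>'.
Proof.
move=> /normal_sum {1}->; rewrite inner_suml; apply: eq_bigr => a _.
by rewrite innerZl.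
Qed.

Lemma gauss_frame u v w z : << calR u v w, z >> =
  k * (<< v, w >> * << u, z >> - << u, w >> * << v, z >>)
  + \sum_a (<< row a X, h v w >>' * << row a X, h u z >>'
            - << row a X, h u w >>' * << row a X, h v z >>').
Proof.
rewrite gauss -addrA; congr (_ + _).
by rewrite !normal_parseval // -sumrB.
Qed.

End NormalFrame.

Lemma hDl u u' v : h (u + u') v = h u v + h u' v.
Proof. by rewrite hC -[u in h v (u + _)]scale1r h_lin scale1r !(hC v). Qed.

Lemma hZl c u v : h (c *: u) v = c *: h u v.
Proof.
have h0 w : h w 0 = 0.
  by have := h_lin w 1 0 0; rewrite !scale1r addr0 => /esym/eqP;
    rewrite -subr_eq0 addrK => /eqP.
by rewrite hC -[c *: u]addr0 h_lin h0 addr0 hC.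
Qed.

Lemma h_suml (I : finType) (F : I -> V) v : h (\sum_i F i) v = \sum_i h (F i) v.
Proof.
elim/big_rec2: _ => [|i x y _ <-]; last by rewrite hDl.
by rewrite -(scale0r 0) hZl scale0r.
Qed.

Definition shape_matrix (E : 'I_n -> V) (nu : V') : 'M[R]_n :=
  \matrix_(i, j) << nu, h (E i) (E j) >>'.

Definition traceless_shape (E : 'I_n -> V) (nu : V') : 'M[R]_n :=
  shape_matrix E nu - (\tr (shape_matrix E nu) / n%:R)%:M.

Local Notation A nu := (sharp g (fun u v => << nu, h u v >>')).

Lemma inner_shape nu u v : << A nu u, v >> = << nu, h u v >>'.
Proof.
rewrite inner_sharp //; first exact: posdef_unit.
by move=> c x y; rewrite h_lin innerDr innerZr.
Qed.

(** Scalar matrices commute with everything, so the traces may be removed. The order is reversed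
    because the image of [E i] is read in row i of a shape matrix. *)
Lemma normal_curvature_comm E nu mu i j : orthonormal g E ->
  << A nu (A mu (E i)) - A mu (A nu (E i)), E j >> =
  comm (traceless_shape E mu) (traceless_shape E nu) i j.
Proof.
move=> oE; have F a b : << A a (A b (E i)), E j >> =
    (shape_matrix E b *m shape_matrix E a) i j.
  rewrite inner_shape (frame_sum gp oE (A b (E i))) h_suml inner_sumr mxE.
  apply: eq_bigr => l _; rewrite hZl innerZr !mxE; congr (_ * _).
  by rewrite innerC // inner_shape.
rewrite innerDl innerNl !F /traceless_shape /comm !mulmxBl !mulmxBr.
rewrite !mul_scalar_mx !mul_mx_scalar !mxE; ring.
Qed.

Lemma traceless_sym E nu : (traceless_shape E nu)^T = traceless_shape E nu.
Proof.
rewrite /traceless_shape linearB /= tr_scalar_mx; congr (_ - _).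
by apply/matrixP => i j; rewrite !mxE hC.
Qed.

Hypothesis n2 : (1 < n)%N.
Let n_neq0 : n%:R != 0 :> R. Proof. by rewrite pnatr_eq0 -lt0n ltnW. Qed.
Let n1_neq0 : n%:R - 1 != 0 :> R.
Proof. by rewrite subr_eq0 pnatr_eq1 gtn_eqF. Qed.

Lemma frob_traceless E nu :
  frob (traceless_shape E nu) (traceless_shape E nu) =
  frob (shape_matrix E nu) (shape_matrix E nu)
  - (\tr (shape_matrix E nu)) ^+ 2 / n%:R.
Proof.
rewrite /traceless_shape -scaleN1r.
have f1 (B : 'M[R]_n) (c : R) : frob B c%:M = c * \tr B.
  by rewrite /frob tr_scalar_mx mul_mx_scalar mxtraceZ.
rewrite !(frobDl, frobDr, frobZl, frobZr) [frob (_%:M) (shape_matrix _ _)]frobC !f1.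
by rewrite mxtrace_scalar -mulr_natr; field.
Qed.

Section Wintgen.
Hypothesis wint : forall (E : 'I_n -> V) (xi : 'I_m -> V'),
  orthonormal g E -> orthonormal g' xi ->
  (forall a w, << xi a, w *m J >>' = 0) ->
  let H := n%:R^-1 *: \sum_i h (E i) (E i) in
  normalized_scalar g calR E = (Num.sqrt << H, H >>') ^+ 2
  - 2 / (n%:R * (n%:R - 1)) *
    Num.sqrt (\sum_(i < n) \sum_(j < n | (i < j)%N)
              \sum_(a < m) \sum_(b < m | (a < b)%N)
      << A (xi a) (A (xi b) (E i)) - A (xi b) (A (xi a) (E i)), E j >> ^+ 2) + k.

Lemma posdef_ge0 (v : V') : 0 <= << v, v >>'.
Proof.
by have [->|/(proj2 gp')/ltW] := eqVneq v 0; rewrite ?inner0l.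
Qed.

(** By the Gauss equation the normalized scalar curvature is k + H^2 - S / (n (n - 1)), and the
    normal one is 2 sqrt(T / 4) / (n (n - 1)) by [sum_comm_upper]. The Wintgen equality thus reduces
    to S = 2 sqrt(T / 4). *)
Lemma wintgen_ddvv (E : 'I_n -> V) (X : 'M[R]_(m, n + m)) :
  orthonormal g E -> X *m g' *m J^T = 0 -> X *m g' *m X^T = 1%:M ->
  let B a := traceless_shape E (row a X) in
  \sum_a \sum_b frob (comm (B a) (B b)) (comm (B a) (B b)) =
  (\sum_a frob (B a) (B a)) ^+ 2.
Proof.
move=> oE XJ XX B.
have := wint oE (frame_orthonormal XX) (frame_normal XJ).
move=> /=.
pose T := \sum_a \sum_b frob (comm (B a) (B b)) (comm (B a) (B b)).
pose S := \sum_a frob (B a) (B a).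
rewrite -/S -/T.
pose t a := \tr (shape_matrix E (row a X)).
have T4 : \sum_(i < n) \sum_(j < n | (i < j)%N)
              \sum_(a < m) \sum_(b < m | (a < b)%N)
      << A (row a X) (A (row b X) (E i)) - A (row b X) (A (row a X) (E i)), E j >> ^+ 2
      = T / 4.
  rewrite {}/T sum_comm_upper => [|a]; last exact: traceless_sym.
  rewrite mulrC mulKf ?pnatr_eq0 //.
  apply: eq_bigr => i _; apply: eq_bigr => j _; apply: eq_bigr => a _.
  by apply: eq_bigr => b _; rewrite normal_curvature_comm.
have HH : << n%:R^-1 *: \sum_i h (E i) (E i), n%:R^-1 *: \sum_i h (E i) (E i) >>' =
    (\sum_a t a ^+ 2) / n%:R ^+ 2.
  have Hn w : << n%:R^-1 *: \sum_i h (E i) (E i), w *m J >>' = 0.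
    by rewrite innerZl inner_suml big1 ?mulr0.
  rewrite (normal_parseval XJ XX _ Hn) mulr_suml; apply: eq_bigr => a _.
  rewrite innerZr inner_sumr (_ : \sum_i _ = t a); first by field.
  by apply: eq_bigr => i _; rewrite mxE.
have NS : normalized_scalar g calR E =
    k + (\sum_a t a ^+ 2) / n%:R ^+ 2 - S / (n%:R * (n%:R - 1)).
  pose f a i j := shape_matrix E (row a X) i i * shape_matrix E (row a X) j j
    - shape_matrix E (row a X) i j ^+ 2.
  pose F i j := k * (1 - (i == j)%:R) + \sum_a f a i j.
  have sM a i j : shape_matrix E (row a X) i j = shape_matrix E (row a X) j i.
    by rewrite !mxE hC.
  have FE i j : lower g calR (E i) (E j) (E j) (E i) = F i j.
    rewrite /lower (gauss_frame XJ XX) !oE !eqxx /F; congr (_ + _).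
      by rewrite [j == i]eq_sym; case: eqP => _ /=; ring.
    apply: eq_bigr => a _; rewrite /f [in X in _ - X ^+ 2]mxE expr2.
    by rewrite !mxE (hC (E j) (E i)); ring.
  have FC i j : F i j = F j i.
    rewrite /F eq_sym; congr (_ + _); apply: eq_bigr => a _.
    by rewrite /f sM; ring.
  have F2 : \sum_i \sum_j F i j = 2 * \sum_(i < n) \sum_(j < n | (i < j)%N) F i j.
    rewrite sum_upper // big1 ?add0r // => i _.
    by rewrite /F eqxx subrr mulr0 add0r big1 // => a _; rewrite /f; ring.
  have F3 : \sum_i \sum_j F i j =
      k * (n%:R * (n%:R - 1)) + \sum_a (t a ^+ 2 * (n%:R - 1) / n%:R) - S.
    have -> : S = \sum_a (frob (shape_matrix E (row a X)) (shape_matrix E (row a X))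
        - t a ^+ 2 / n%:R).
      by apply: eq_bigr => a _; rewrite frob_traceless.
    rewrite -addrA -sumrB; under eq_bigr do rewrite big_split /=.
    rewrite big_split /=; congr (_ + _).
      have d1 (i : 'I_n) : \sum_j k * (1 - (i == j)%:R) = k * (n%:R - 1).
        rewrite -mulr_sumr sumrB sumr_const card_ord; congr (_ * (_ - _)).
        rewrite (bigD1 i) //= eqxx big1 ?addr0 // => j.
        by rewrite eq_sym => /negPf ->.
      by rewrite (eq_bigr _ (fun i _ => d1 i)) sumr_const card_ord -mulr_natr; ring.
    under eq_bigr do rewrite exchange_big /=.
    rewrite exchange_big /=; apply: eq_bigr => a _.
    under eq_bigr do rewrite sumrB -mulr_sumr.
    rewrite sumrB -mulr_suml -!/(t a) frobE.
    have -> : \sum_i \sum_j shape_matrix E (row a X) i j ^+ 2 =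
      \sum_i \sum_j shape_matrix E (row a X) i j * shape_matrix E (row a X) i j.
      by apply: eq_bigr => i _; apply: eq_bigr => j _; rewrite expr2.
    by rewrite /t /mxtrace; field.
  rewrite /normalized_scalar.
  under eq_bigr do under eq_bigr do rewrite FE.
  have -> : \sum_(i < n) \sum_(j < n | (i < j)%N) F i j = (\sum_i \sum_j F i j) / 2.
    by rewrite F2 mulrC mulKf ?pnatr_eq0.
  rewrite F3 -!mulr_suml; field.
  by rewrite n_neq0 n1_neq0.
rewrite T4 sqr_sqrtr ?posdef_ge0 // HH NS => eqn.
have T0 : 0 <= T / 4.
  by rewrite divr_ge0 //; apply: sumr_ge0 => a _; apply: sumr_ge0 => b _; apply: frob_ge0.
have -> : S = 2 * Num.sqrt (T / 4).
  apply: (@mulIf _ (n%:R * (n%:R - 1))^-1); first by rewrite invr_neq0 // mulf_neq0.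
  by rewrite mulrAC; lra.
by rewrite exprMn sqr_sqrtr //; field.
Qed.

Lemma shape_matrix_lin E c nu mu :
  shape_matrix E (c *: nu + mu) = c *: shape_matrix E nu + shape_matrix E mu.
Proof. by apply/matrixP => i j; rewrite !mxE innerDl innerZl. Qed.

Lemma traceless_shape_lin E c nu mu : traceless_shape E (c *: nu + mu) =
  c *: traceless_shape E nu + traceless_shape E mu.
Proof.
rewrite /traceless_shape shape_matrix_lin mxtraceD mxtraceZ.
by apply/matrixP => i j; rewrite !mxE; case: (i == j); rewrite ?mulr1n ?mulr0n; ring.
Qed.

Lemma traceless_shape_sum E (I : finType) (c : I -> R) (nu : I -> V') :
  traceless_shape E (\sum_i c i *: nu i) = \sum_i c i *: traceless_shape E (nu i).
Proof.
apply: (big_rec2 (fun x y => traceless_shape E x = y)) => [|i x y _ <-].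
  have := traceless_shape_lin E 1 0 0; rewrite !scale1r addr0 => /esym/eqP.
  by rewrite -subr_eq0 addrK => /eqP.
exact: traceless_shape_lin.
Qed.

(** The traceless shape matrix is linear in the normal vector, so rotating the normal frame
    conjugates the Gram matrix [G] of these matrices, and [G] can be diagonalised. *)
Lemma orthogonal_normal_frame (E : 'I_n -> V) :
  exists X : 'M[R]_(m, n + m), [/\ X *m g' *m J^T = 0, X *m g' *m X^T = 1%:M &
    forall a b, a != b ->
      frob (traceless_shape E (row a X)) (traceless_shape E (row b X)) = 0].
Proof.
have [X [XJ XX]] := posdef_complement_frame gp' immersion_row_free.
pose B a := traceless_shape E (row a X).
pose G : 'M[R]_m := \matrix_(a, b) frob (B a) (B b).
have [Q [d [QQ Qd]]] : exists (Q : 'M[R]_m) (d : 'rV[R]_m),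
    Q *m Q^T = 1%:M /\ Q *m G *m Q^T = diag_mx d.
  by apply: sym_spectral; apply/matrixP => a b; rewrite !mxE frobC.
exists (Q *m X); split.
- by rewrite -!mulmxA (mulmxA X) XJ mulmx0.
- have -> : Q *m X *m g' *m (Q *m X)^T = Q *m (X *m g' *m X^T) *m Q^T.
    by rewrite trmx_mul !mulmxA.
  by rewrite XX mulmx1.
move=> a b ab.
have BQ i : traceless_shape E (row i (Q *m X)) = \sum_c Q i c *: B c.
  rewrite row_mul mulmx_sum_row traceless_shape_sum.
  by apply: eq_bigr => c _; rewrite mxE.
rewrite !BQ.
have -> : frob (\sum_c Q a c *: B c) (\sum_c Q b c *: B c) = (Q *m G *m Q^T) a b.
  rewrite /frob mulmx_suml raddf_sum mxE.
  under [RHS]eq_bigr do rewrite mxE mulr_suml.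
  rewrite [RHS]exchange_big /=; apply: eq_bigr => c _.
  rewrite linear_sum mulmx_sumr raddf_sum; apply: eq_bigr => e _.
  by rewrite linearZ /= -scalemxAr -scalemxAl !mxtraceZ !mxE /frob; ring.
by rewrite Qd mxE (negPf ab).
Qed.

Lemma shape_matrix_rotate E (P : 'M[R]_n) nu :
  shape_matrix (fun i => \sum_l P i l *: E l) nu = conj P (shape_matrix E nu).
Proof.
apply/matrixP => i j; rewrite mxE h_suml inner_sumr [RHS]mxE.
under [RHS]eq_bigr do rewrite mxE mulr_suml.
rewrite [RHS]exchange_big /=; apply: eq_bigr => l _.
rewrite hZl hC h_suml innerZr inner_sumr mulr_sumr; apply: eq_bigr => e _.
by rewrite hZl innerZr hC !mxE; ring.
Qed.

Lemma traceless_shape_rotate E (P : 'M[R]_n) nu : orthogonal_mx P ->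
  traceless_shape (fun i => \sum_l P i l *: E l) nu =
  conj P (traceless_shape E nu).
Proof.
move=> Po; rewrite /traceless_shape shape_matrix_rotate trace_conj //.
rewrite /conj mulmxBr mulmxBl; congr (_ - _).
by rewrite mul_mx_scalar -scalemxAl Po scalemx1.
Qed.

Lemma wintgen_plane_frame : exists (E : 'I_n -> V) (X : 'M[R]_(m, n + m)) c j,
  [/\ orthonormal g E, X *m g' *m J^T = 0, X *m g' *m X^T = 1%:M, c != j &
      forall a, plane_shape c j (traceless_shape E (row a X))].
Proof.
have [E oE] := frame_exists gp.
have [X [XJ XX oX]] := orthogonal_normal_frame E.
have := ddvv_equality (fun a => traceless_sym E (row a X)) oX (wintgen_ddvv oE XJ XX).
move=> [B0|[P [c [j [Po cj PB]]]]].
  (* All traceless parts vanish, so any plane will do; the one of the indices 0 and 1 is taken. *)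
  exists E, X, (Ordinal (ltnW n2)), (Ordinal n2); split=> // a.
  by rewrite B0; split=> [i l|]; rewrite !mxE ?eqxx ?oppr0.
exists (fun i => \sum_l P i l *: E l), X, c, j; split=> //.
  exact: frame_rotate.
by move=> a; rewrite traceless_shape_rotate.
Qed.

Lemma wintgen_second_form :
  exists (E : 'I_n -> V) (X : 'M[R]_(m, n + m)) c j (t x y : 'I_m -> R),
  [/\ orthonormal g E, X *m g' *m J^T = 0, X *m g' *m X^T = 1%:M, c != j &
      forall a u v, << row a X, h u v >>' =
        t a * << u, v >> + plane_form g (E c) (E j) (x a) (y a) u v].
Proof.
have [E [X [c [j [oE XJ XX cj BX]]]]] := wintgen_plane_frame.
pose B a := traceless_shape E (row a X).
exists E, X, c, j, (fun a => \tr (shape_matrix E (row a X)) / n%:R),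
  (fun a => B a c c), (fun a => B a c j); split=> // a u v.
have -> : << row a X, h u v >>' =
    \sum_i \sum_l << E i, u >> * << E l, v >> * shape_matrix E (row a X) i l.
  rewrite {1}(frame_sum gp oE u) h_suml inner_sumr; apply: eq_bigr => i _.
  rewrite hZl innerZr hC {1}(frame_sum gp oE v) h_suml inner_sumr mulr_sumr.
  by apply: eq_bigr => l _; rewrite hZl innerZr hC mxE mulrA.
have uv : << u, v >> = \sum_i \sum_l << E i, u >> * << E l, v >> * (i == l)%:R.
  rewrite {1}(frame_sum gp oE u) inner_suml; apply: eq_bigr => i _.
  rewrite innerZl (bigD1 i) //= eqxx mulr1 big1 ?addr0 // => l.
  by rewrite eq_sym => /negPf ->; rewrite mulr0.
have BE i l : B a i l = shape_matrix E (row a X) i l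
    - \tr (shape_matrix E (row a X)) / n%:R * (i == l)%:R.
  by rewrite /B /traceless_shape !mxE mulr_natr.
have PS := plane_shape_sum (fun i => << E i, u >>) (fun i => << E i, v >>) cj
  (traceless_sym E (row a X)) (BX a).
rewrite uv /plane_form -PS mulr_sumr -big_split /=; apply: eq_bigr => i _.
by rewrite mulr_sumr -big_split /=; apply: eq_bigr => l _; rewrite BE; ring.
Qed.

(** The part of the Gauss equation quadratic in a form on a plane is its determinant times the
    square of p ^ q, and a traceless form has determinant -(x^2 + y^2). The second form is returned
    along with the curvature, since umbilicity is read off from [x] and [y] once the coefficient of
    that part vanishes. *)
Lemma wintgen_curvature : exists (E : 'I_n -> V) (X : 'M[R]_(m, n + m)) c j
    (t x y : 'I_m -> R),
  [/\ orthonormal g E, X *m g' *m J^T = 0, X *m g' *m X^T = 1%:M, c != j &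
      forall a u v, << row a X, h u v >>' =
        t a * << u, v >> + plane_form g (E c) (E j) (x a) (y a) u v] /\
  forall u v w z, << calR u v w, z >> =
  (k + \sum_a t a ^+ 2) * (<< v, w >> * << u, z >> - << u, w >> * << v, z >>)
  + (let D := plane_form g (E c) (E j) (\sum_a t a * x a) (\sum_a t a * y a) in
     << v, w >> * D u z + D v w * << u, z >>
     - << u, w >> * D v z - D u w * << v, z >>)
  - (\sum_a (x a ^+ 2 + y a ^+ 2))
    * (<< E c, u >> * << E j, v >> - << E j, u >> * << E c, v >>)
    * (<< E c, z >> * << E j, w >> - << E j, z >> * << E c, w >>).
Proof.
have [E [X [c [j [t [x [y [oE XJ XX cj hE]]]]]]]] := wintgen_second_form.
exists E, X, c, j, t, x, y; split=> // u v w z; rewrite (gauss_frame XJ XX).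
pose M1 := << v, w >> * << u, z >> - << u, w >> * << v, z >>.
pose M (P : V -> V -> R) := << v, w >> * P u z + P v w * << u, z >>
     - << u, w >> * P v z - P u w * << v, z >>.
pose P1 := plane_form g (E c) (E j) 1 0; pose P2 := plane_form g (E c) (E j) 0 1.
pose M4 := (<< E c, u >> * << E j, v >> - << E j, u >> * << E c, v >>)
    * (<< E c, z >> * << E j, w >> - << E j, z >> * << E c, w >>).
transitivity (k * M1 + \sum_a (t a ^+ 2 * M1 + t a * x a * M P1 + t a * y a * M P2
    - (x a ^+ 2 + y a ^+ 2) * M4)).
  congr (_ + _); apply: eq_bigr => a _; rewrite !hE.
  rewrite /M /P1 /P2 /M1 /M4 /plane_form; ring.
rewrite sumrB !big_split /= -!mulr_suml !big_split /=.
rewrite /M1 /M /P1 /P2 /M4 /plane_form; ring.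
Qed.

Lemma wintgen_umbilical : (4 <= n)%N ->
  linearly_dependent (C_dot_R g calR) (Q_g_gRicc g calR) ->
  forall E : 'I_n -> V, orthonormal g E -> forall u v,
  h u v = << u, v >> *: (n%:R^-1 *: \sum_i h (E i) (E i)).
Proof.
move=> n4 dep.
have [E0 [X [c [j [t [x [y [[oE0 XJ XX cj hE] RE]]]]]]]] := wintgen_curvature.
have w0 : \sum_a (x a ^+ 2 + y a ^+ 2) = 0.
  apply/eqP/negPn/negP => w0.
  have [e [f [eI fI ef]]] : exists e f, [/\ e \in ~: [set c; j]%SET,
      f \in ~: [set c; j]%SET & e != f].
    apply/card_gt1P; rewrite cardsCs finset.setCK card_ord cards2 cj.
    by rewrite ltn_subRL.
  move: eI fI; rewrite !inE !negb_or => /andP[ec ej] /andP[fc fj].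
  have oii i : << E0 i, E0 i >> = 1 by rewrite oE0 eqxx.
  have oij i l : i != l -> << E0 i, E0 l >> = 0 by rewrite oE0 => /negPf ->.
  have oji i l : i != l -> << E0 l, E0 i >> = 0 by rewrite eq_sym; apply: oij.
  exact: (plane_curvature_independent gp n4 (oii c) (oii j) (oij _ _ cj) RE w0
    (oii e) (oii f) (oij _ _ ef) (oji _ _ ec) (oji _ _ ej) (oji _ _ fc)
    (oji _ _ fj)) dep.
have xy0 a : x a = 0 /\ y a = 0.
  have xy_ge0 b : 0 <= x b ^+ 2 + y b ^+ 2 by rewrite addr_ge0 // sqr_ge0.
  move/eqP: w0; rewrite psumr_eq0 // => /allP/(_ a (mem_index_enum _)) /=.
  by rewrite paddr_eq0 ?sqr_ge0 // !sqrf_eq0 => /andP[/eqP -> /eqP ->].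
pose H := \sum_a t a *: row a X.
have hH u v : h u v = << u, v >> *: H.
  rewrite (normal_sum XJ XX (h_normal u v)) scaler_sumr; apply: eq_bigr => a _.
  rewrite hE (proj1 (xy0 a)) (proj2 (xy0 a)) scalerA /plane_form.
  by congr (_ *: _); ring.
move=> E oE u v; rewrite hH; congr (_ *: _).
rewrite (eq_bigr (fun=> H)) => [|i _]; last by rewrite hH oE eqxx scale1r.
by rewrite sumr_const card_ord -[X in _ *: X]scaler_nat scalerA mulVf // scale1r.
Qed.

End Wintgen.

Section Umbilical.
Variable H : V'.
Hypothesis umb : forall u v, h u v = << u, v >> *: H.
Hypothesis n4 : (4 <= n)%N.

Let calRE u v w z : << calR u v w, z >> =
  (k + << H, H >>') * (<< v, w >> * << u, z >> - << u, w >> * << v, z >>).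
Proof. by rewrite gauss !umb !innerE; ring. Qed.

(** Constant curvature is the degenerate case [xi = eta = omega = 0] of the plane model, with an
    arbitrary orthonormal pair as [p] and [q]. *)
Lemma umbilical_weyl_op x y z : weyl_op g calR x y z = 0.
Proof.
have [E oE] := frame_exists gp; apply: (inner_nondeg gp) => t.
have oii i : << E i, E i >> = 1 by rewrite oE eqxx.
have o01 : << E (Ordinal (ltnW n2)), E (Ordinal n2) >> = 0 by rewrite oE.
rewrite (@plane_weylE _ _ g calR _ _ (k + << H, H >>') 0 0 0 gp n4 (oii _) (oii _) o01).
  by rewrite !innerE; ring.
by move=> u v w s; rewrite calRE /plane_form; ring.
Qed.

Lemma umbilical_dependent : linearly_dependent (C_dot_R g calR) (Q_g_gRicc g calR).
Proof.
exists 1, 0; split=> [|x1 x2 x3 x4 x y]; first by rewrite oner_eq0.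
rewrite /C_dot_R /derivation_action /lower !umbilical_weyl_op !calRE !innerE.
ring.
Qed.

End Umbilical.
End SecondForm.

(** * Differential calculus *)

Section MatrixDerivatives.
Variables (R : realType) (V : normedModType R).
Implicit Types (x v : V).

Lemma is_derive_mxP m n (M : V -> 'M[R]_(m, n)) x v dM :
  is_derive x v M dM <->
  forall i j, is_derive x v (fun y => M y i j) (dM i j).
Proof.
split=> [[Md <-] i j|Md].
  by apply: DeriveDef; [exact: (derivable_mxP _ _ _).1|rewrite derive_mx ?mxE].
have Mder : derivable M x v.
  by apply/derivable_mxP => i j; exact: (@ex_derive _ _ _ _ _ _ _ (Md i j)).
apply: DeriveDef => //; apply/matrixP => i j; rewrite derive_mx // mxE.
exact: (@derive_val _ _ _ _ _ _ _ (Md i j)).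
Qed.

Lemma is_derive_big (W : normedModType R) (I : Type) (r : seq I) (P : pred I)
    (h : I -> V -> W) (dh : I -> W) x v :
  (forall i, is_derive x v (h i) (dh i)) ->
  is_derive x v (fun y => \sum_(i <- r | P i) h i y) (\sum_(i <- r | P i) dh i).
Proof.
move=> hd; elim: r => [|i r IHr].
  rewrite big_nil (_ : (fun _ => _) = cst 0); first exact: is_derive_cst.
  by apply/funext => y; rewrite big_nil.
rewrite big_cons; case: ifP => Pi.
  rewrite (_ : (fun _ => _) = h i + (fun y => \sum_(i <- r | P i) h i y)).
    exact: is_deriveD.
  by apply/funext => y; rewrite big_cons Pi.
rewrite (_ : (fun _ => _) = (fun y => \sum_(i <- r | P i) h i y)) //.
by apply/funext => y; rewrite big_cons Pi.
Qed.

Lemma is_derive_mulmx m n p (A : V -> 'M[R]_(m, n)) (B : V -> 'M[R]_(n, p))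
    x v dA dB : is_derive x v A dA -> is_derive x v B dB ->
  is_derive x v (fun y => A y *m B y) (dA *m B x + A x *m dB).
Proof.
move=> /is_derive_mxP Ad /is_derive_mxP Bd; apply/is_derive_mxP => i j.
rewrite (_ : (fun _ => _) = fun y => \sum_k A y i k * B y k j); last first.
  by apply/funext => y; rewrite mxE.
rewrite !mxE -big_split /=; apply: is_derive_big => k.
have H := is_deriveM (Ad i k) (Bd k j); apply: (is_derive_eq H).
by rewrite addrC; congr (_ + _); exact: mulrC.
Qed.

Lemma is_derive_trmx m n (A : V -> 'M[R]_(m, n)) x v dA :
  is_derive x v A dA -> is_derive x v (fun y => (A y)^T) dA^T.
Proof.
move=> /is_derive_mxP Ad; apply/is_derive_mxP => i j.
rewrite (_ : (fun _ => _) = fun y => A y j i); last by apply/funext => y; rewrite mxE.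
by rewrite mxE.
Qed.

Lemma is_derive_inner n (g : V -> 'M[R]_n) (a b : V -> 'rV[R]_n) x v dg da db :
  is_derive x v g dg -> is_derive x v a da -> is_derive x v b db ->
  is_derive x v (fun y => inner (g y) (a y) (b y))
    (inner dg (a x) (b x) + inner (g x) da (b x) + inner (g x) (a x) db).
Proof.
move=> gd ad bd.
have := is_derive_mulmx (is_derive_mulmx ad gd) (is_derive_trmx bd).
move=> /is_derive_mxP/(_ 0 0) H; apply: (is_derive_eq H).
by rewrite !mulmxDl 2!mxE [X in X + _]addrC.
Qed.

Lemma derivable_prod (I : Type) (r : seq I) (h : I -> V -> R) x v :
  (forall i, derivable (h i) x v) -> derivable (fun y => \prod_(i <- r) h i y) x v.
Proof.
move=> hd; elim: r => [|i r IHr].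
  rewrite (_ : (fun _ => _) = cst 1); first exact: derivable_cst.
  by apply/funext => y; rewrite big_nil.
rewrite (_ : (fun _ => _) = h i * (fun y => \prod_(i <- r) h i y)).
  exact: derivableM.
by apply/funext => y; rewrite big_cons.
Qed.

Lemma derivable_big (W : normedModType R) (I : Type) (r : seq I)
    (h : I -> V -> W) x v :
  (forall i, derivable (h i) x v) -> derivable (fun y => \sum_(i <- r) h i y) x v.
Proof.
move=> hd; apply: (@ex_derive _ _ _ _ _ _ (\sum_(i <- r) 'D_v (h i) x)).
by apply: is_derive_big => i; apply: derivableP.
Qed.

Lemma derivable_det n (A : V -> 'M[R]_n) x v :
  derivable A x v -> derivable (fun y => \det (A y)) x v.
Proof.
move=> /derivable_mxP Ad; rewrite /determinant; apply: derivable_big => s.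
by apply: derivableM; [exact: derivable_cst|apply: derivable_prod => i].
Qed.

(** By Cramer's formula the entries are cofactors over the determinant. Invertibility is assumed
    near [x] because [invmx] is given by this formula on units only. *)
Lemma derivable_invmx n (A : V -> 'M[R]_n) x v :
  (\forall y \near x, A y \in unitmx) -> derivable A x v ->
  derivable (fun y => invmx (A y)) x v.
Proof.
move=> uA Ad.
have near_inv : \near x, (\det (A x))^-1 *: \adj (A x) = invmx (A x).
  by near=> y; rewrite /invmx ifT //; near: y.
apply: (near_eq_derivable near_inv); apply/derivable_mxP => i j.
rewrite (_ : (fun _ => _) =
    (fun y => (\det (A y))^-1) * (fun y => cofactor (A y) j i)); last first.
  by apply/funext => y; rewrite !mxE.
apply: derivableM.
  apply: derivableV; last exact: derivable_det.
  by have := nbhs_singleton uA; rewrite unitmxE unitfE.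
rewrite /cofactor; apply: derivableM; first exact: derivable_cst.
apply: derivable_det; apply/derivable_mxP => k l.
rewrite (_ : (fun _ => _) = fun y => A y (lift j k) (lift i l)).
  by move/derivable_mxP: Ad; apply.
by apply/funext => y; rewrite !mxE.
Unshelve. all: by end_near. Qed.

End MatrixDerivatives.

Section ChainRule.
Variables (R : realType) (U V W : normedModType R).

Lemma is_derive_chain (F : U -> V) (H : V -> W) x u :
  differentiable F x -> differentiable H (F x) ->
  is_derive x u (H \o F) ('D_('D_u F x) H (F x)).
Proof.
move=> dF dH; have dHF := differentiable_comp dF dH.
apply: DeriveDef; first exact: diff_derivable.
by rewrite !deriveE // diff_comp.
Qed.

Lemma derive_linear (H : V -> W) x : differentiable H x ->
  linear (fun v => 'D_v H x).
Proof.
by move=> dH c u v; rewrite !deriveE // linearP.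
Qed.

Lemma derivable_line (H : V -> W) (p v : V) s l : is_derive (p + s *: v) v H l ->
  is_derive s 1 (fun t : R => H (p + t *: v)) l.
Proof.
have E : (fun h : R => h^-1 *: (((fun t : R => H (p + t *: v)) \o shift s) (h *: 1)
      - H (p + s *: v))) =
    (fun h => h^-1 *: ((H \o shift (p + s *: v)) (h *: v) - H (p + s *: v))).
  apply/funext => h /=; congr (_ *: (H _ - _)).
  by rewrite [h *: 1]mulr1 scalerDl addrA addrAC addrC addrA.
move=> [Hd Hl]; apply: DeriveDef; first by rewrite /derivable /= E.
by rewrite -Hl /derive /= E.
Qed.

End ChainRule.

(** * Symmetry of second derivatives *)

Section Schwarz.
Variables (R : realType) (V : normedModType R).

(** Two applications of the mean value theorem: along [u] to the difference of [phi] on two opposite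
    sides of the parallelogram, then along [v] to the derivative [a] so obtained. *)
Lemma second_difference (phi a c : V -> R) (p u v : V) (t : R) : 0 < t ->
  (forall s r, 0 <= s <= t -> 0 <= r <= t ->
    is_derive (p + s *: u + r *: v) u phi (a (p + s *: u + r *: v)) /\
    is_derive (p + s *: u + r *: v) v a (c (p + s *: u + r *: v))) ->
  exists s r, [/\ 0 <= s <= t, 0 <= r <= t &
    phi (p + t *: u + t *: v) - phi (p + t *: u) - phi (p + t *: v) + phi p
    = c (p + s *: u + r *: v) * t ^+ 2].
Proof.
move=> t0 H; have tt : 0 <= t <= t by rewrite ltW //=.
have z0 : 0 <= (0 : R) <= t by rewrite lexx ltW.
have d1 r : 0 <= r <= t -> forall s, 0 <= s <= t ->
    is_derive s 1 (fun s : R => phi ((p + r *: v) + s *: u)) (a (p + s *: u + r *: v)).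
  move=> rt s st; apply: derivable_line.
  by rewrite addrAC; apply: (proj1 (H s r st rt)).
pose f (s : R) := phi ((p + t *: v) + s *: u) - phi ((p + 0 *: v) + s *: u).
pose df s := a (p + s *: u + t *: v) - a (p + s *: u + 0 *: v).
have fd s : 0 <= s <= t -> is_derive s 1 f (df s).
  by move=> st; apply: is_deriveB; apply: d1.
have [s st fE] : exists2 s, s \in `]0, t[%R & f t - f 0 = df s * (t - 0).
  apply: MVT => //.
    by move=> s; rewrite in_itv /= => /andP[s0 s1]; apply: fd; rewrite !ltW.
  apply: derivable_within_continuous => s; rewrite in_itv /= => st.
  exact: (@ex_derive _ _ _ _ _ _ _ (fd s st)).
have st' : 0 <= s <= t by move: st; rewrite in_itv /= => /andP[? ?]; rewrite !ltW.
pose h (r : R) := a ((p + s *: u) + r *: v).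
have hd r : 0 <= r <= t -> is_derive r 1 h (c (p + s *: u + r *: v)).
  by move=> rt; apply: derivable_line; apply: (proj2 (H s r st' rt)).
have [r rt hE] : exists2 r, r \in `]0, t[%R &
    h t - h 0 = c (p + s *: u + r *: v) * (t - 0).
  apply: (@MVT _ h (fun r => c (p + s *: u + r *: v))) => //.
    by move=> r; rewrite in_itv /= => /andP[r0 r1]; apply: hd; rewrite !ltW.
  apply: derivable_within_continuous => r; rewrite in_itv /= => rt.
  exact: (@ex_derive _ _ _ _ _ _ _ (hd r rt)).
exists s, r; split=> //; first by move: rt; rewrite in_itv /= => /andP[? ?]; rewrite !ltW.
move: fE hE; rewrite /f /df /h !scale0r !addr0 subr0 => fE hE.
rewrite expr2 mulrA -hE -fE addrAC [p + t *: v + _]addrAC; ring.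
Qed.

(** The second difference does not depend on the order of [u] and [v], so on any small parallelogram
    a value of [c] equals a value of [d]; by continuity this excludes [c x != d x]. *)
Theorem schwarz (phi a b c d : V -> R) (U : set V) (x u v : V) :
  open U -> U x ->
  (forall y, U y -> is_derive y u phi (a y)) ->
  (forall y, U y -> is_derive y v phi (b y)) ->
  (forall y, U y -> is_derive y v a (c y)) ->
  (forall y, U y -> is_derive y u b (d y)) ->
  {for x, continuous c} -> {for x, continuous d} -> c x = d x.
Proof.
move=> Uo Ux ua vb vc ud cc dc; apply/eqP/negPn/negP => cd.
pose e := `|c x - d x| / 2.
have e0 : 0 < e by rewrite divr_gt0 // normr_gt0 subr_eq0.
have : \forall y \near x, [/\ U y, `|c x - c y| < e & `|d x - d y| < e].
  near=> y; split; near: y.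
  - exact: open_nbhs_nbhs.
  - by move/cvgrPdist_lt : cc; apply.
  - by move/cvgrPdist_lt : dc; apply.
move=> /nbhs_ballP[r /= r0 rP].
(* A parallelogram with sides [t *: u] and [t *: v] stays within t N = r / 2 of [x]; the summand 1
   keeps [N] positive even if both vectors vanish. *)
pose N := `|u| + `|v| + 1.
have N0 : 0 < N by rewrite ltr_wpDl // addr_ge0.
pose t := r / (2 * N).
have t0 : 0 < t by rewrite divr_gt0 // mulr_gt0.
have box s s' : 0 <= s <= t -> 0 <= s' <= t ->
    [/\ U (x + s *: u + s' *: v), `|c x - c (x + s *: u + s' *: v)| < e &
       `|d x - d (x + s *: u + s' *: v)| < e].
  move=> /andP[s0 st] /andP[s'0 s't]; apply: rP; rewrite -ball_normE /ball_ /=.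
  rewrite -addrA opprD addrA subrr sub0r normrN.
  apply: (le_lt_trans (ler_normD _ _)); rewrite !normrZ !ger0_norm //.
  have : s * `|u| + s' * `|v| <= t * N.
    rewrite /N !mulrDr -[leLHS]addr0 lerD // ?lerD ?ler_wpM2r //.
    by rewrite mulr1 ltW.
  have -> : t * N = r / 2 by rewrite /t; field; rewrite gt_eqF.
  by move=> /le_lt_trans; apply; lra.
have [s [s' [st s't E1]]] : exists s s', [/\ 0 <= s <= t, 0 <= s' <= t &
    phi (x + t *: u + t *: v) - phi (x + t *: u) - phi (x + t *: v) + phi x
    = c (x + s *: u + s' *: v) * t ^+ 2].
  apply: (second_difference (a := a)) => // s s' st s't.
  by have [Us _ _] := box s s' st s't; split; auto.
have [q [q' [qt q't E2]]] : exists s s', [/\ 0 <= s <= t, 0 <= s' <= t &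
    phi (x + t *: v + t *: u) - phi (x + t *: v) - phi (x + t *: u) + phi x
    = d (x + s *: v + s' *: u) * t ^+ 2].
  apply: (second_difference (a := b)) => // q q' qt q't.
  by rewrite addrAC; have [Uq _ _] := box q' q q't qt; split; auto.
have cdE : c (x + s *: u + s' *: v) = d (x + q *: v + q' *: u).
  apply: (@mulIf _ (t ^+ 2)); first by rewrite expf_neq0 // gt_eqF.
  by rewrite -E1 -E2 [x + t *: v + _]addrAC; ring.
have [_ h1 _] := box s s' st s't; have [_ _ h2] := box q' q q't qt.
have : `|c x - d x| < e + e.
  rewrite addrAC -cdE in h2.
  rewrite (_ : c x - d x = (c x - c (x + s *: u + s' *: v))
     - (d x - c (x + s *: u + s' *: v))); last by ring.
  by apply: le_lt_trans (ler_normB _ _) _; apply: ltrD.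
by rewrite /e -splitr ltxx.
Unshelve. all: by end_near. Qed.

End Schwarz.

(* Locked, as unification would otherwise unfold the limit behind 'D_u f x. *)
HB.lock Definition mxD (R : realType) (n p q : nat) (u : 'rV[R]_n)
  (f : 'rV[R]_n -> 'M[R]_(p, q)) (x : 'rV[R]_n) : 'M[R]_(p, q) := 'D_u f x.

Lemma mxDE (R : realType) n p q (u : 'rV[R]_n) (f : 'rV[R]_n -> 'M[R]_(p, q)) :
  mxD u f = 'D_u f.
Proof. by rewrite mxD.unlock. Qed.

Section Smooth.
Variables (R : realType) (n : nat) (U : set 'rV[R]_n).

Lemma smooth_differentiable (W : normedModType R) (f : 'rV[R]_n -> W) x :
  smooth_on U f -> U x -> differentiable f x.
Proof. by move=> /(_ [::] x). Qed.

Lemma smooth_derive (W : normedModType R) (f : 'rV[R]_n -> W) v :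
  smooth_on U f -> smooth_on U ('D_v f).
Proof. by move=> fs vs x Ux; have := fs (rcons vs v) x Ux; rewrite foldr_rcons. Qed.

Section MatrixValued.
Variables (p q : nat) (f : 'rV[R]_n -> 'M[R]_(p, q)).
Hypothesis fs : smooth_on U f.

Lemma smooth_mxD v : smooth_on U (mxD v f).
Proof. by rewrite mxDE; exact: smooth_derive. Qed.

Lemma smooth_is_derive x u : U x -> is_derive x u f (mxD u f x).
Proof. by move=> Ux; rewrite mxDE; apply/derivableP/diff_derivable/smooth_differentiable. Qed.

Lemma mxD_lin x c u v : U x ->
  mxD (c *: u + v) f x = c *: mxD u f x + mxD v f x.
Proof. by move=> Ux; rewrite !mxDE; exact: (derive_linear (smooth_differentiable fs Ux)). Qed.

Lemma mxD0 x : mxD 0 f x = 0.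
Proof. by rewrite mxDE; exact: derive0. Qed.

End MatrixValued.

Lemma smooth_schwarz p q (f : 'rV[R]_n -> 'M[R]_(p, q)) x u v :
  open U -> smooth_on U f -> U x -> mxD u (mxD v f) x = mxD v (mxD u f) x.
Proof.
move=> Uo fs Ux; apply/matrixP => i j.
have entry (h : 'rV[R]_n -> 'M[R]_(p, q)) y w : smooth_on U h -> U y ->
    is_derive y w (fun y => h y i j) (mxD w h y i j).
  by move=> hs Uy; exact: ((is_derive_mxP _ _ _ _).1 (smooth_is_derive hs w Uy) i j).
have cts (h : 'rV[R]_n -> 'M[R]_(p, q)) : smooth_on U h ->
    {for x, continuous (fun y => h y i j)}.
  move=> hs; apply: differentiable_continuous.
  apply: (@differentiable_comp _ _ _ _ h (fun N : 'M[R]_(p, q) => N i j)).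
    exact: smooth_differentiable.
  exact: differentiable_coord.
have su w := smooth_mxD fs w.
apply: (@schwarz _ _ (fun y => f y i j) (fun y => mxD v f y i j)
  (fun y => mxD u f y i j) (fun y => mxD u (mxD v f) y i j)
  (fun y => mxD v (mxD u f) y i j) U x v u) => //.
- by move=> y; apply: entry.
- by move=> y; apply: entry.
- by move=> y; apply: entry.
- by move=> y; apply: entry.
- by apply: cts; apply: smooth_mxD.
- by apply: cts; apply: smooth_mxD.
Qed.

End Smooth.

Lemma is_derive_inner_cst (R : realType) (V : normedModType R) n
    (g : V -> 'M[R]_n) x u dg p q :
  is_derive x u g dg -> is_derive x u (fun y => inner (g y) p q) (inner dg p q).
Proof.
move=> gd; have := is_derive_inner gd (is_derive_cst p x u) (is_derive_cst q x u).
by rewrite inner0l inner0r !addr0.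
Qed.

(** * Curvature of a metric in a chart *)

HB.lock Definition connection (R : realType) (n : nat) (G : 'rV[R]_n -> 'M[R]_n)
  (x u v : 'rV[R]_n) : 'rV[R]_n := christoffel G x u v.

Lemma christoffel_connection (R : realType) n (G : 'rV[R]_n -> 'M[R]_n) x u v :
  christoffel G x u v = connection G x u v.
Proof. by rewrite connection.unlock. Qed.

Section ChartMetric.
Variables (R : realType) (n : nat) (U : set 'rV[R]_n) (G : 'rV[R]_n -> 'M[R]_n).
Hypotheses (Uo : open U) (Gs : smooth_on U G).
Hypothesis Gp : forall x, U x -> posdef (G x).
Local Notation V := 'rV[R]_n.
Implicit Types (x u v w z : V).

Definition koszul x u v w : R :=
  2^-1 * (inner (mxD u G x) v w + inner (mxD v G x) u w - inner (mxD w G x) u v).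

Lemma metric_unit x : U x -> G x \in unitmx.
Proof. by move=> /Gp/posdef_unit. Qed.

Lemma metric_sym_at x : U x -> (G x)^T = G x.
Proof. by move=> /Gp[]. Qed.

Lemma near_dom x : U x -> \near x, U x.
Proof. by move=> Ux; apply: open_nbhs_nbhs. Qed.

Lemma derive_metric_sym x u : U x -> (mxD u G x)^T = mxD u G x.
Proof.
move=> Ux; have [_ <-] := is_derive_trmx (smooth_is_derive Gs u Ux).
rewrite mxDE; apply: near_eq_derive; near=> y; apply: metric_sym_at.
by near: y; apply: near_dom.
Unshelve. all: by end_near. Qed.

Lemma derive2_metric_sym x u v : U x -> (mxD u (mxD v G) x)^T = mxD u (mxD v G) x.
Proof.
move=> Ux; have [_ <-] := is_derive_trmx (smooth_is_derive (smooth_mxD Gs v) u Ux).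
rewrite [in RHS]mxDE; apply: near_eq_derive; near=> y; apply: derive_metric_sym.
by near: y; apply: near_dom.
Unshelve. all: by end_near. Qed.

Lemma derive_metric_lin x (c : R) u v (p q : V) : U x ->
  inner (mxD (c *: u + v) G x) p q =
  c * inner (mxD u G x) p q + inner (mxD v G x) p q.
Proof.
move=> Ux; rewrite (mxD_lin Gs) //.
by rewrite /inner mulmxDr mulmxDl -scalemxAr -scalemxAl mxE [X in X + _]mxE.
Qed.

Lemma koszul_lin x u v (c : R) (p q : V) : U x ->
  koszul x u v (c *: p + q) = c * koszul x u v p + koszul x u v q.
Proof.
move=> Ux; rewrite /koszul.
rewrite derive_metric_lin //.
by rewrite !innerE; ring.
Qed.

Lemma koszul_linr x u w (c : R) (p q : V) : U x ->
  koszul x u (c *: p + q) w = c * koszul x u p w + koszul x u q w.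
Proof.
by move=> Ux; rewrite /koszul derive_metric_lin // !innerE; ring.
Qed.

Lemma connectionE x u v : U x ->
  connection G x u v = sharp (G x) (fun v w => koszul x u v w) v.
Proof.
move=> Ux; rewrite -christoffel_connection /christoffel; congr (sharp _ _ _).
apply/funext => p; apply/funext => q; rewrite /koszul.
by rewrite !(@derive_val _ _ _ _ _ _ _ (is_derive_inner_cst _ _ (smooth_is_derive Gs _ Ux))).
Qed.

Lemma inner_connection x u v w : U x ->
  inner (G x) (connection G x u v) w = koszul x u v w.
Proof.
move=> Ux; rewrite connectionE // inner_sharp //; first exact: metric_unit.
by move=> c p q; exact: koszul_lin.
Qed.

Lemma connectionC x u v : U x -> connection G x u v = connection G x v u.
Proof.
move=> Ux; apply: (inner_nondeg (Gp Ux)) => w; rewrite !inner_connection //.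
by rewrite /koszul (innerC v u (derive_metric_sym w Ux)); ring.
Qed.

Lemma connection_lin x u : U x -> linear (connection G x u).
Proof.
move=> Ux c p q; apply: (inner_nondeg (Gp Ux)) => w.
by rewrite !innerE !inner_connection // koszul_linr.
Qed.

Lemma connection0l x v : U x -> connection G x 0 v = 0.
Proof.
move=> Ux; apply: (inner_nondeg (Gp Ux)) => w; rewrite inner_connection // /koszul.
by rewrite mxD0 !innerE /inner mulmx0 mul0mx mxE; ring.
Qed.

Definition koszul_derive x u v w z : R :=
  2^-1 * (inner (mxD u (mxD v G) x) w z + inner (mxD u (mxD w G) x) v z
          - inner (mxD u (mxD z G) x) v w).

Lemma is_derive_koszul x u v w z : U x ->
  is_derive x u (fun y => koszul y v w z) (koszul_derive x u v w z).
Proof.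
move=> Ux; have D p q s := is_derive_inner_cst q s
  (smooth_is_derive (smooth_mxD Gs p) u Ux).
have H := is_deriveZ (2^-1) (is_deriveB (is_deriveD (D v w z) (D w v z)) (D z v w)).
exact: (is_derive_eq H).
Qed.

Lemma derivable_connection x u v w : U x ->
  derivable (fun y => connection G y v w) x u.
Proof.
move=> Ux.
have E : \near x, (\row_j koszul x v w (delta_mx 0 j)) *m invmx (G x) =
    connection G x v w.
  by near=> y; rewrite connectionE //; near: y; apply: near_dom.
apply: (near_eq_derivable E).
apply: ex_derive; apply: is_derive_mulmx; apply: derivableP.
  apply/derivable_mxP => i j.
  rewrite (_ : (fun _ => _) = fun y => koszul y v w (delta_mx 0 j)).
    exact: (@ex_derive _ _ _ _ _ _ _ (is_derive_koszul u v w _ Ux)).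
  by apply/funext => y; rewrite mxE.
apply: derivable_invmx.
  by near=> y; apply: metric_unit; near: y; apply: near_dom.
exact: (@ex_derive _ _ _ _ _ _ _ (smooth_is_derive Gs u Ux)).
Unshelve. all: by end_near. Qed.

(** The product rule is applied to [inner (G y) (connection G y v w) z], which is the Koszul
    expression. So derivability of the connection is all that is needed, not a formula for its
    derivative. *)
Lemma inner_derive_connection x u v w z : U x ->
  inner (G x) (mxD u (fun y => connection G y v w) x) z =
  koszul_derive x u v w z - inner (mxD u G x) (connection G x v w) z.
Proof.
move=> Ux; have Gd : is_derive x u (fun y => connection G y v w)
    (mxD u (fun y => connection G y v w) x).
  by rewrite mxDE; apply/derivableP/derivable_connection.
have H := is_derive_inner (smooth_is_derive Gs u Ux) Gd (is_derive_cst z x u).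
have H' : is_derive x u (fun y => inner (G y) (connection G y v w) z)
    (koszul_derive x u v w z).
  apply: near_eq_is_derive (is_derive_koszul u v w z Ux).
  by near=> y; rewrite inner_connection //; near: y; apply: near_dom.
have := @derive_val _ _ _ _ _ _ _ H; rewrite (@derive_val _ _ _ _ _ _ _ H').
by rewrite inner0r addr0 /= => ->; rewrite [X in _ = X - _]addrC addrK.
Unshelve. all: by end_near. Qed.

Lemma curvatureE x u v w : U x -> curvature G x u v w =
  mxD u (fun y => connection G y v w) x - mxD v (fun y => connection G y u w) x
  + connection G x u (connection G x v w)
  - connection G x v (connection G x u w).
Proof.
move=> Ux; rewrite /curvature /curvature_field !mxDE.
have nE p q : nabla G (cst p) (cst q) = fun y => connection G y p q.
  by apply/funext => y; rewrite /nabla derive_cst add0r christoffel_connection.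
rewrite !nE /nabla !christoffel_connection.
have -> : lie_bracket (cst u) (cst v) = cst 0.
  by apply/funext => y; rewrite /lie_bracket !derive_cst subrr.
by rewrite derive_cst connection0l //= !addr0 subr0 opprD addrACA addrA.
Qed.

Lemma metric_compatible x u p q : U x ->
  inner (mxD u G x) p q = koszul x u p q + koszul x u q p.
Proof.
move=> Ux; rewrite /koszul (innerC q p (derive_metric_sym u Ux)).
by field.
Qed.

(** Metric compatibility splits [mxD u G] at the pair of [connection G x v w] and [z] into two
    products: one cancels the composed connection term, the other is a product of two connection
    vectors. *)
Lemma inner_curvature x u v w z : U x ->
  inner (G x) (curvature G x u v w) z =
  koszul_derive x u v w z - koszul_derive x v u w z
  - inner (G x) (connection G x v w) (connection G x u z)
  + inner (G x) (connection G x u w) (connection G x v z).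
Proof.
move=> Ux; rewrite curvatureE // !innerE !inner_derive_connection //.
rewrite (metric_compatible u _ _ Ux) (metric_compatible v _ _ Ux).
rewrite -(inner_connection u z (connection G x v w) Ux).
rewrite -(inner_connection v z (connection G x u w) Ux).
rewrite (inner_connection u _ z Ux) (inner_connection v _ z Ux).
rewrite (innerC (connection G x u z) _ (metric_sym_at Ux)).
rewrite (innerC (connection G x v z) _ (metric_sym_at Ux)).
by ring.
Qed.

End ChartMetric.

(* Polarizing the last hypothesis makes K skew in its second and third         *)
(* arguments, hence in the first three, and Bianchi's identity reads 3 K = 0.   *)
Lemma curvature_form_eq0 (R : realFieldType) (V : zmodType) (K : V -> V -> V -> V -> R) :
  (forall u v w z t, K u v w (z + t) = K u v w z + K u v w t) ->
  (forall u v w z, K v u w z = - K u v w z) ->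
  (forall u v w z, K u v z w = - K u v w z) ->
  (forall u v w z, K u v w z + K v w u z + K w u v z = 0) ->
  (forall u v, K u v v u = 0) ->
  forall u v w z, K u v w z = 0.
Proof.
move=> addK skew12 skew34 bianchi K0.
(* The classical derivation of the pair symmetry: a combination of the Bianchi identities of the
   four cyclic shifts. *)
have pair u v w z : K w z u v = K u v w z.
  have := bianchi u v w z; rewrite (skew12 u w v z).
  have := bianchi v w z u; rewrite (skew34 v w u z) (skew34 w z u v).
  rewrite (skew12 v z w u) (skew34 v z u w).
  have := bianchi w z u v; rewrite (skew12 u z w v) (skew34 u z v w) (skew34 u w v z).
  have := bianchi z u v w; rewrite (skew12 u z v w) (skew34 u v w z).
  lra.
have add1 u v w z t : K (z + t) u v w = K z u v w + K t u v w.
  by rewrite -(pair (z + t) u) -(pair z u) -(pair t u) !(skew34 v w u) addK opprD.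
have add2 u v w z t : K u (z + t) v w = K u z v w + K u t v w.
  by rewrite !(skew12 _ u) add1; lra.
have add3 u v w z t : K u v (z + t) w = K u v z w + K u v t w.
  by rewrite !(skew34 u v w) addK; lra.
have K1 u v z : K u v v z = 0.
  have := K0 (u + z) v; rewrite add1 !addK !K0.
  by rewrite -[K z v v u]pair (skew12 u v) (skew34 u v v z); lra.
have K2 u v w z : K u w v z = - K u v w z.
  by have := K1 u (v + w) z; rewrite add2 !add3 !K1; lra.
move=> u v w z; have := bianchi u v w z.
by rewrite (K2 v u w) (skew12 u v) (skew12 u w) (K2 u v w); lra.
Qed.

(** * Constant sectional curvature determines the curvature tensor *)

Section ConstantCurvature.
Variables (R : realType) (n : nat) (U : set 'rV[R]_n) (G : 'rV[R]_n -> 'M[R]_n).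
Hypotheses (Uo : open U) (Gs : smooth_on U G).
Hypothesis Gp : forall x, U x -> posdef (G x).
Local Notation V := 'rV[R]_n.
Variables (x : V).
Hypothesis Ux : U x.

Definition riemann u v w z : R := koszul_derive G x u v w z - koszul_derive G x v u w z
  - inner (G x) (connection G x v w) (connection G x u z)
  + inner (G x) (connection G x u w) (connection G x v z).

Local Notation K := riemann.

Lemma curvature_skew12 u v w z : K v u w z = - K u v w z.
Proof. by rewrite /riemann; ring. Qed.

Lemma derive2_metricC u v p q :
  inner (mxD u (mxD v G) x) q p = inner (mxD u (mxD v G) x) p q.
Proof. by apply: innerC; exact: (derive2_metric_sym Uo Gs Gp u v Ux). Qed.

(** The derivatives of the metric along both [u] and [v] cancel by symmetry of second derivatives;
    what remains is visibly skew in [w] and [z]. *)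
Lemma koszul_derive_skew u v w z :
  koszul_derive G x u v w z - koszul_derive G x v u w z = 2^-1 *
  (inner (mxD u (mxD w G) x) v z - inner (mxD u (mxD z G) x) v w
   - inner (mxD v (mxD w G) x) u z + inner (mxD v (mxD z G) x) u w).
Proof. by rewrite /koszul_derive (smooth_schwarz v u Uo Gs Ux); ring. Qed.

Lemma curvature_skew34 u v w z : K u v z w = - K u v w z.
Proof.
rewrite /riemann (koszul_derive_skew u v z w) (koszul_derive_skew u v w z).
rewrite (innerC (connection G x v w) (connection G x u z) (proj1 (Gp Ux))).
rewrite (innerC (connection G x v z) (connection G x u w) (proj1 (Gp Ux))).
by ring.
Qed.

Lemma curvature_bianchi u v w z : K u v w z + K v w u z + K w u v z = 0.
Proof.
rewrite /riemann (koszul_derive_skew u v) (koszul_derive_skew v w) (koszul_derive_skew w u).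
rewrite (connectionC Uo Gs Gp v u Ux) (connectionC Uo Gs Gp w u Ux).
rewrite (connectionC Uo Gs Gp w v Ux).
rewrite (derive2_metricC u z v w) (derive2_metricC v z u w) (derive2_metricC w z u v).
rewrite (smooth_schwarz v u Uo Gs Ux) (smooth_schwarz w u Uo Gs Ux).
rewrite (smooth_schwarz w v Uo Gs Ux).
by ring.
Qed.

Lemma constant_curvature_form k :
  (forall u v, row_free (col_mx u v) -> sectional (G x) (curvature G x) u v = k) ->
  forall u v w z, inner (G x) (curvature G x u v w) z =
    k * (inner (G x) v w * inner (G x) u z - inner (G x) u w * inner (G x) v z).
Proof.
move=> Kk; pose g := G x; have gp : posdef g := Gp Ux.
pose T u v w z := K u v w z - k * (inner g v w * inner g u z - inner g u w * inner g v z).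
have KE u v w z : inner g (curvature G x u v w) z = K u v w z.
  exact: (inner_curvature Uo Gs Gp u v w z Ux).
suff T0 u v w z : T u v w z = 0.
  by move=> u v w z; rewrite KE; apply/eqP; rewrite -subr_eq0; apply/eqP/T0.
have gC p q : inner g q p = inner g p q by apply: innerC; exact: (proj1 gp).
apply: curvature_form_eq0 => {u v w z} [u v w z t|u v w z|u v w z|u v w z|u v].
- by rewrite /T -!KE; move: (curvature _ _ _ _ _) => r; rewrite !innerE; ring.
- by rewrite /T (curvature_skew12 u v); ring.
- by rewrite /T (curvature_skew34 u v w z); ring.
- rewrite /T; have := curvature_bianchi u v w z.
  move: (K u v w z) (K v w u z) (K w u v z) => a b c; rewrite (gC u v) (gC u w) (gC v w).
  by move=> E; rewrite -[RHS]E; ring.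
have skew : K u v v u = K v u u v.
  by rewrite (curvature_skew12 v u) (curvature_skew34 v u u v) opprK.
have Kself p q w : K p q w w = 0 by have := curvature_skew34 p q w w; lra.
rewrite /T; have [->|u0] := eqVneq u 0; first by rewrite -KE !inner0r !inner0l; ring.
have [/sub_rVP[c ->]|vu] := boolP (v <= u)%MS.
  have -> : K u (c *: u) (c *: u) u = 0.
    rewrite (curvature_skew12 (c *: u) u) (curvature_skew34 (c *: u) u u (c *: u)).
    by rewrite -KE innerZr KE Kself; ring.
  by rewrite !innerE; ring.
have uv_free : row_free (col_mx u v).
  rewrite -row_leq_rank -addsmxE; have : (u < u + v)%MS.
    by rewrite ltmxE addsmxSl /= addsmx_sub submx_refl.
  by rewrite ltmxErank rank_rV u0 => /andP[].
(* A multiple of the component of [v] orthogonal to [u]. Its square norm is [inner g u u] times the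
   denominator of the sectional curvature, which is therefore positive and can be cleared. *)
pose w := inner g u u *: v - inner g u v *: u.
have w0 : w != 0.
  apply: contra vu; rewrite subr_eq0 => /eqP E; apply/sub_rVP.
  exists ((inner g u u)^-1 * inner g u v); rewrite -scalerA -E scalerA mulVf ?scale1r //.
  by rewrite gt_eqF //; apply: (proj2 gp).
have uu : 0 < inner g u u by apply: (proj2 gp).
have : 0 < inner g w w by apply: (proj2 gp).
have -> : inner g w w =
    inner g u u * (inner g u u * inner g v v - inner g u v ^+ 2).
  by rewrite /w !innerE (gC u v); ring.
rewrite pmulr_rgt0 // => D0.
have := Kk u v uv_free; rewrite /sectional /lower -/g KE.
move=> /(congr1 (fun t => t * (inner g u u * inner g v v - inner g u v ^+ 2))).
by rewrite divfK ?gt_eqF // => ->; rewrite (gC u v); ring.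
Qed.

End ConstantCurvature.

(** * The Gauss equation *)

Lemma is_derive_scale (R : realType) (V : normedModType R) p q (c : V -> R)
    (M : V -> 'M[R]_(p, q)) x v dc dM :
  is_derive x v c dc -> is_derive x v M dM ->
  is_derive x v (fun y => c y *: M y) (c x *: dM + dc *: M x).
Proof.
move=> cd /is_derive_mxP Md; apply/is_derive_mxP => i j.
rewrite (_ : (fun _ => _) = c * (fun y => M y i j)); last first.
  by apply/funext => y; rewrite mxE.
have H := is_deriveM cd (Md i j); apply: (is_derive_eq H).
by rewrite !mxE; congr (_ + _); exact: mulrC.
Qed.

Lemma innerDg (R : realType) n (g g' : 'M[R]_n) u v :
  inner (g + g') u v = inner g u v + inner g' u v.
Proof. by rewrite /inner mulmxDr mulmxDl mxE. Qed.

Section GaussEquation.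
Variables (R : realType) (n p : nat).
Variables (U : set 'rV[R]_n) (U' : set 'rV[R]_p).
Variables (G : 'rV[R]_n -> 'M[R]_n) (G' : 'rV[R]_p -> 'M[R]_p).
Variable F : 'rV[R]_n -> 'rV[R]_p.
Hypotheses (Uo : open U) (Gs : smooth_on U G).
Hypothesis Gp : forall x, U x -> posdef (G x).
Hypotheses (U'o : open U') (G's : smooth_on U' G').
Hypothesis G'p : forall y, U' y -> posdef (G' y).
Hypothesis Fs : smooth_on U F.
Hypothesis FU : forall x, U x -> U' (F x).
Hypothesis iso : forall x, U x -> forall u v,
  inner (G x) u v = inner (G' (F x)) (mxD u F x) (mxD v F x).
Local Notation V := 'rV[R]_n.
Local Notation V' := 'rV[R]_p.
Implicit Types (x u v w z : V).

Lemma is_derive_comp q r (h : V' -> 'M[R]_(q, r)) x u :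
  smooth_on U' h -> U x ->
  is_derive x u (fun y => h (F y)) (mxD (mxD u F x) h (F x)).
Proof.
move=> hs Ux; rewrite !mxDE; apply: is_derive_chain.
  exact: (smooth_differentiable Fs).
exact: (smooth_differentiable hs (FU Ux)).
Qed.

Lemma mxD_sum q r (h : V' -> 'M[R]_(q, r)) (y a : V') : smooth_on U' h -> U' y ->
  mxD a h y = \sum_i a 0 i *: mxD (delta_mx 0 i) h y.
Proof.
move=> hs Uy; have DD (b c : V') : mxD (b + c) h y = mxD b h y + mxD c h y.
  by rewrite -[b in LHS]scale1r (mxD_lin hs) // scale1r.
have DZ (c : R) (b : V') : mxD (c *: b) h y = c *: mxD b h y.
  by rewrite -[c *: b]addr0 (mxD_lin hs) // mxD0 addr0.
rewrite {1}[a]row_sum_delta (big_morph (fun b => mxD b h y) DD (mxD0 _ _)).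
by apply: eq_bigr => i _; exact: DZ.
Qed.

(** The direction of differentiation moves with the point, so the derivative is expanded over the
    fixed basis directions, with the coordinates of [a] as coefficients. *)
Lemma is_derive_mxD (a : V -> V') da x u :
  U x -> is_derive x u a da ->
  is_derive x u (fun y => mxD (a y) G' (F y))
    (mxD da G' (F x) + mxD (mxD u F x) (mxD (a x) G') (F x)).
Proof.
move=> Ux ad; have Uy := FU Ux.
have nE : \near x, \sum_i a x 0 i *: mxD (delta_mx 0 i) G' (F x) = mxD (a x) G' (F x).
  by near=> y; rewrite -(mxD_sum _ G's) //; apply: FU; near: y; apply: near_dom.
apply: (near_eq_is_derive nE).
have H : is_derive x u (fun y => \sum_i a y 0 i *: mxD (delta_mx 0 i) G' (F y))
    (\sum_i (a x 0 i *: mxD (mxD u F x) (mxD (delta_mx 0 i) G') (F x)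
      + da 0 i *: mxD (delta_mx 0 i) G' (F x))).
  apply: is_derive_big => i.
  have D1 := (is_derive_mxP _ _ _ _).1 ad 0 i.
  exact: (is_derive_scale D1 (is_derive_comp u (smooth_mxD G's (delta_mx 0 i)) Ux)).
apply: (is_derive_eq H); rewrite big_split /= addrC -mxD_sum //; congr (_ + _).
rewrite (smooth_schwarz _ _ U'o G's Uy) (mxD_sum _ (smooth_mxD G's _) Uy).
by apply: eq_bigr => i _; rewrite (smooth_schwarz _ _ U'o G's Uy).
Unshelve. all: by end_near. Qed.

Lemma metric_pullback x u v w : U x -> inner (mxD u G x) v w =
  inner (mxD (mxD u F x) G' (F x)) (mxD v F x) (mxD w F x)
  + inner (G' (F x)) (mxD u (mxD v F) x) (mxD w F x)
  + inner (G' (F x)) (mxD v F x) (mxD u (mxD w F) x).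
Proof.
move=> Ux; have D1 := is_derive_inner_cst v w (smooth_is_derive Gs u Ux).
have D2 := is_derive_inner (is_derive_comp u G's Ux)
  (smooth_is_derive (smooth_mxD Fs v) u Ux) (smooth_is_derive (smooth_mxD Fs w) u Ux).
rewrite -(@derive_val _ _ _ _ _ _ _ D1) -(@derive_val _ _ _ _ _ _ _ D2).
apply: near_eq_derive; near=> y; apply: iso; near: y; exact: near_dom.
Unshelve. all: by end_near. Qed.

(** Of the six products with second derivatives of [F] in the Koszul sum, four cancel by symmetry
    and the other two are equal, which absorbs the factor 1/2. *)
Lemma koszul_pullback x u v w : U x -> koszul G x u v w =
  koszul G' (F x) (mxD u F x) (mxD v F x) (mxD w F x)
  + inner (G' (F x)) (mxD u (mxD v F) x) (mxD w F x).
Proof.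
move=> Ux; rewrite /koszul !metric_pullback //.
have gC a b : inner (G' (F x)) b a = inner (G' (F x)) a b.
  by apply: innerC; exact: (proj1 (G'p (FU Ux))).
rewrite (smooth_schwarz v u Uo Fs Ux) (smooth_schwarz w u Uo Fs Ux).
rewrite (smooth_schwarz w v Uo Fs Ux).
rewrite (gC (mxD v F x) (mxD u (mxD w F) x)).
by field.
Qed.

Definition gauss_form x u v : V' := mxD u (mxD v F) x
  + connection G' (F x) (mxD u F x) (mxD v F x) - mxD (connection G x u v) F x.

Lemma gauss_formC x u v : U x -> gauss_form x u v = gauss_form x v u.
Proof.
move=> Ux; rewrite /gauss_form (smooth_schwarz v u Uo Fs Ux).
by rewrite (connectionC Uo Gs Gp v u Ux) (connectionC U'o G's G'p _ _ (FU Ux)).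
Qed.

Lemma gauss_form_normal x u v w : U x ->
  inner (G' (F x)) (gauss_form x u v) (mxD w F x) = 0.
Proof.
move=> Ux; rewrite /gauss_form !innerE -iso // (inner_connection Gs Gp _ _ _ Ux).
rewrite koszul_pullback // (inner_connection G's G'p _ _ _ (FU Ux)).
by ring.
Qed.

(** The derivative along [u] of the right-hand side of [koszul_pullback]. Its terms with [f2 u v]
    and with the third derivative of [F] are symmetric in [u] and [v], hence vanish in the
    curvature. *)
Definition koszul_derive_pullback x u v w z : R :=
  let g' := G' (F x) in
  let D a := mxD (mxD a F x) G' (F x) in
  let f a := mxD a F x in
  let f2 a b := mxD a (mxD b F) x in
  koszul_derive G' (F x) (f u) (f v) (f w) (f z)
  + koszul G' (F x) (f2 u v) (f w) (f z)
  + koszul G' (F x) (f v) (f2 u w) (f z)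
  + koszul G' (F x) (f v) (f w) (f2 u z)
  + inner (D u) (f2 v w) (f z)
  + inner g' (mxD u (mxD v (mxD w F)) x) (f z) + inner g' (f2 v w) (f2 u z).

Lemma koszul_deriveE x u v w z : U x ->
  koszul_derive G x u v w z = koszul_derive_pullback x u v w z.
Proof.
move=> Ux; have D1 := is_derive_koszul Gs u v w z Ux.
have df a := smooth_is_derive (smooth_mxD Fs a) u Ux.
have df2 := smooth_is_derive (smooth_mxD (smooth_mxD Fs w) v) u Ux.
have DG a b c := is_derive_inner (is_derive_mxD Ux (df a)) (df b) (df c).
have D2 := is_deriveD
  (is_deriveZ (2^-1) (is_deriveB (is_deriveD (DG v w z) (DG w v z)) (DG z v w)))
  (is_derive_inner (is_derive_comp u G's Ux) df2 (df z)).
rewrite -(@derive_val _ _ _ _ _ _ _ D1).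
transitivity ('D_u (fun y => koszul G' (F y) (mxD v F y) (mxD w F y) (mxD z F y)
  + inner (G' (F y)) (mxD v (mxD w F) y) (mxD z F y)) x).
  apply: near_eq_derive; near=> y; apply: koszul_pullback; near: y; exact: near_dom.
rewrite (@derive_val _ _ _ _ _ _ _ D2) /koszul_derive_pullback /koszul_derive /koszul.
set T := (X in 2^-1 *: X); change (2^-1 *: T) with (2^-1 * T); rewrite {}/T.
by rewrite !innerDg; ring.
Unshelve. all: by end_near. Qed.

(** After pulling back, the two curvatures differ by products of ambient covariant derivatives of
    the fields [mxD w F], minus the products of connection vectors of [G]. The latter are the
    tangential parts, so the normal parts remain. *)
Lemma gauss_equation x u v w z : U x ->
  inner (G x) (curvature G x u v w) z =
  inner (G' (F x)) (curvature G' (F x) (mxD u F x) (mxD v F x) (mxD w F x)) (mxD z F x)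
  + inner (G' (F x)) (gauss_form x v w) (gauss_form x u z)
  - inner (G' (F x)) (gauss_form x u w) (gauss_form x v z).
Proof.
move=> Ux; have Uy := FU Ux.
rewrite (inner_curvature Uo Gs Gp _ _ _ _ Ux) (inner_curvature U'o G's G'p _ _ _ _ Uy).
have gC a b : inner (G' (F x)) b a = inner (G' (F x)) a b.
  by apply: innerC; exact: (proj1 (G'p Uy)).
rewrite !koszul_deriveE // /koszul_derive_pullback /=.
rewrite (smooth_schwarz v u Uo (smooth_mxD Fs w) Ux) (smooth_schwarz v u Uo Fs Ux).
rewrite !(metric_compatible U'o G's G'p _ _ _ Uy) !iso //.
rewrite -!(inner_connection G's G'p _ _ _ Uy).
(* The ambient covariant derivative of [mxD b F] along [mxD a F]. By [N], its orthogonal splitting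
   into normal and tangential parts carries over to products. *)
pose D a b := mxD a (mxD b F) x + connection G' (F x) (mxD a F x) (mxD b F x).
have fE a b : D a b = gauss_form x a b + mxD (connection G x a b) F x.
  by rewrite /D /gauss_form subrK.
have N a b c d : inner (G' (F x)) (D a b) (D c d) =
   inner (G' (F x)) (gauss_form x a b) (gauss_form x c d)
   + inner (G' (F x)) (mxD (connection G x a b) F x) (mxD (connection G x c d) F x).
  have := gauss_form_normal a b (connection G x c d) Ux.
  have := gauss_form_normal c d (connection G x a b) Ux.
  rewrite !fE; move: (gauss_form x a b) (gauss_form x c d) => h1 h2 n2 n1.
  by rewrite innerDl !innerDr n1 (gC h2 (mxD _ F x)) n2; ring.
have := N v w u z; have := N u w v z; rewrite /D.
move: (gauss_form x v w) (gauss_form x u z) (gauss_form x u w) (gauss_form x v z).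
move=> h1 h2 h3 h4; rewrite !innerDl !innerDr.
rewrite (gC (connection G' (F x) (mxD u F x) (mxD z F x)) (mxD v (mxD w F) x)).
rewrite (gC (connection G' (F x) (mxD v F x) (mxD z F x)) (mxD u (mxD w F) x)).
lra.
Qed.
End GaussEquation.

(** * Submanifolds of space forms *)

Section ChartTheorem.
Variables (R : realType) (n m : nat) (k : R).
Variables (U : set 'rV[R]_n) (U' : set 'rV[R]_(n + m)).
Variables (G : 'rV[R]_n -> 'M[R]_n) (G' : 'rV[R]_(n + m) -> 'M[R]_(n + m)).
Variable F : 'rV[R]_n -> 'rV[R]_(n + m).
Hypotheses (Uo : open U) (Gs : smooth_on U G).
Hypothesis Gp : forall x, U x -> posdef (G x).
Hypotheses (U'o : open U') (G's : smooth_on U' G').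
Hypothesis G'p : forall y, U' y -> posdef (G' y).
Hypothesis Fs : smooth_on U F.
Hypothesis FU : forall x, U x -> U' (F x).
Hypothesis iso : local_isometry_on U G G' F.
Hypothesis G'k : forall y, U' y -> forall u v, row_free (col_mx u v) ->
  sectional (G' y) (curvature G' y) u v = k.
Hypothesis n4 : (4 <= n)%N.
Variable x : 'rV[R]_n.
Hypothesis Ux : U x.
Local Notation h := (second_form G G' F x).

Let Uy := FU Ux.
Let n2 : (1 < n)%N := ltn_trans (erefl : 1 < 3)%N n4.

Let iso' y : U y -> forall u v,
  inner (G y) u v = inner (G' (F y)) (mxD u F y) (mxD v F y).
Proof. by move=> Uy' u v; rewrite iso // !mxDE. Qed.

Lemma second_formE u v : h u v = gauss_form G G' F x u v.
Proof. by rewrite /second_form !christoffel_connection /gauss_form !mxDE. Qed.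

Lemma gauss_space_form u v w z : inner (G x) (curvature G x u v w) z =
  k * (inner (G x) v w * inner (G x) u z - inner (G x) u w * inner (G x) v z)
  + inner (G' (F x)) (h v w) (h u z) - inner (G' (F x)) (h u w) (h v z).
Proof.
rewrite !second_formE (gauss_equation Uo Gs Gp U'o G's G'p Fs FU iso' u v w z Ux).
by rewrite (constant_curvature_form U'o G's G'p Uy (G'k Uy)) !iso'.
Qed.

Lemma second_form_lin u : linear (h u).
Proof.
move=> c p q; rewrite !second_formE /gauss_form.
rewrite !(smooth_schwarz u _ Uo Fs Ux) (mxD_lin (smooth_mxD Fs u)) //.
rewrite (connection_lin Gs Gp) // !(mxD_lin Fs) // (connection_lin G's G'p) //.
by rewrite scalerBr scalerDr opprD (addrACA (c *: _)) [LHS]addrACA.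
Qed.

Lemma chart_umbilical : wintgen_equality_at G G' F x k ->
  linearly_dependent (C_dot_R (G x) (curvature G x)) (Q_g_gRicc (G x) (curvature G x)) ->
  umbilical_at G G' F x.
Proof.
move=> wint dep E oE; pose J := \matrix_i mxD (delta_mx 0 i) F x.
have JE w : w *m J = mxD w F x.
  by rewrite mulmx_sum_row (mxD_sum _ Fs) //; apply: eq_bigr => i _; rewrite rowK.
have gJ : J *m G' (F x) *m J^T = G x.
  apply/matrixP => i j; rewrite inner_row !rowK -iso' //.
  by rewrite /inner -rowE trmx_delta -colE !mxE.
have hC u v : h u v = h v u.
  by rewrite !second_formE (gauss_formC Uo Gs Gp U'o G's G'p Fs FU).
have hn u v w : inner (G' (F x)) (h u v) (w *m J) = 0.
  by rewrite second_formE JE; apply: (gauss_form_normal Uo Gs Gp G's G'p Fs FU iso').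
apply: (wintgen_umbilical (Gp Ux) (G'p Uy) gJ hC second_form_lin hn
  gauss_space_form n2 _ n4 dep oE) => E' xi oE' oxi nxi.
by apply: wint => // a u; have := nxi a u; rewrite JE mxDE.
Qed.

(** Umbilicity is quantified over orthonormal frames, so it yields a vector only because such a
    frame exists. *)
Lemma umbilical_vector : umbilical_at G G' F x ->
  exists H, forall u v, h u v = inner (G x) u v *: H.
Proof.
by move=> umb; have [E oE] := frame_exists (Gp Ux); eexists; exact: umb oE.
Qed.

Lemma chart_dependent : umbilical_at G G' F x ->
  linearly_dependent (C_dot_R (G x) (curvature G x)) (Q_g_gRicc (G x) (curvature G x)).
Proof.
move=> /umbilical_vector[H hH].
exact: (umbilical_dependent (Gp Ux) gauss_space_form n2 hH n4).
Qed.

Lemma chart_weyl u v w z : umbilical_at G G' F x ->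
  weyl (G x) (curvature G x) u v w z = 0.
Proof.
move=> /umbilical_vector[H hH]; rewrite /weyl /lower.
by rewrite (umbilical_weyl_op (Gp Ux) gauss_space_form n2 hH n4) inner0l.
Qed.

End ChartTheorem.

Section Submanifold.
Variables (R : realType) (n p : nat).
Variables (M : riemannian_manifold R n) (N : riemannian_manifold R p).
Variable f : M -> N.

Lemma open_local_dom (c : chart R n M) (d : chart R p N) :
  continuous f -> is_chart c -> is_chart d -> open (local_dom f c d).
Proof.
move=> fc [_ co _ _ pc] [d_o _ _ _ _]; rewrite openE => x [cx dx].
have pcx : {for x, continuous (param c)}.
  by move: pc; rewrite continuous_open_subspace //; apply; rewrite inE.
have fpc : {for x, continuous (f \o param c)} by exact: continuous_comp pcx (fc _).
have : \near x, dom d ((f \o param c) x).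
  by move: (fpc (dom d)); apply; apply: open_nbhs_nbhs.
have : \near x, cod c x by apply: open_nbhs_nbhs.
by apply: filterS2 => y; split.
Qed.

Lemma posdef_metric (c : chart R n M) x : atlas c -> cod c x -> posdef (metric c x).
Proof. by move=> cM cx; split; [exact: metric_sym|exact: metric_pos]. Qed.

End Submanifold.

Lemma smooth_on_sub (R : realType) n (W : normedModType R) (U U' : set 'rV[R]_n)
    (h : 'rV[R]_n -> W) :
  U `<=` U' -> smooth_on U' h -> smooth_on U h.
Proof. by move=> UU hs vs x /UU; exact: hs. Qed.

Theorem theorem15 (R : realType) (n m : nat) (k : R)
    (M : riemannian_manifold R n) (N : riemannian_manifold R (n + m))
    (f : M -> N) :
  (4 <= n)%N -> (1 <= m)%N ->
  constant_curvature N k ->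
  isometric_immersion f ->
  wintgen_ideal f k ->
  (C_dot_R_Q_g_gRicc_dependent M <-> totally_umbilical f)
  /\ (totally_umbilical f -> conformally_flat M).
Proof.
move=> n4 _ Nk [fc fi] wint.
have FU (c : chart R n M) (d : chart R (n + m) N) x :
  local_dom f c d x -> cod d (local_rep f c d x) by case=> _ dx; exists (f (param c x)).
have sub (c : chart R n M) (d : chart R (n + m) N) : local_dom f c d `<=` cod c by move=> x [].
(* The dependence and the Weyl tensor involve charts of [M] alone, whereas umbilicity involves pairs
   of charts; the covering of [N] supplies the second chart. *)
have near_chart (c : chart R n M) x : cod c x ->
    exists2 d, atlas d & local_dom f c d x.
  by move=> cx; have [d dN dx] := atlas_cover (f (param c x)); exists d.
have op (c : chart R n M) (d : chart R (n + m) N) : atlas c -> atlas d ->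
    open (local_dom f c d).
  by move=> cM dN; apply: open_local_dom => //; exact: atlas_charts.
have cod_open (d : chart R (n + m) N) : atlas d -> open (cod d).
  by move=> /atlas_charts[].
have Gs (c : chart R n M) (d : chart R (n + m) N) : atlas c ->
    smooth_on (local_dom f c d) (metric c).
  by move=> cM; apply: smooth_on_sub (sub c d) (metric_smooth cM).
have Gp (c : chart R n M) (d : chart R (n + m) N) x : atlas c ->
    local_dom f c d x -> posdef (metric c x).
  by move=> cM [cx _]; exact: posdef_metric.
have G'p (d : chart R (n + m) N) (dN : atlas d) := fun y => posdef_metric (x := y) dN.
have G'k (d : chart R (n + m) N) (dN : atlas d) := fun y => Nk d y dN.
have umb_weyl (c : chart R n M) x : atlas c -> cod c x -> totally_umbilical f ->
    linearly_dependent (C_dot_R (metric c x) (curvature (metric c) x))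
      (Q_g_gRicc (metric c x) (curvature (metric c) x)) /\
    forall u v w z, weyl (metric c x) (curvature (metric c) x) u v w z = 0.
  move=> cM cx umb; have [d dN Ux] := near_chart c x cx; have [Fs iso] := fi c d cM dN.
  have u := umb c d cM dN x Ux; split.
    exact: (chart_dependent (op c d cM dN) (Gs c d cM) (fun y => Gp c d y cM)
      (cod_open d dN) (metric_smooth dN) (G'p d dN) Fs (FU c d) iso (G'k d dN) n4 Ux u).
  move=> ? ? ? ?.
  exact: (chart_weyl (op c d cM dN) (Gs c d cM) (fun y => Gp c d y cM)
      (cod_open d dN) (metric_smooth dN) (G'p d dN) Fs (FU c d) iso
      (G'k d dN) n4 Ux _ _ _ _ u).
split; last by move=> umb c x cM cx; exact: (umb_weyl c x cM cx umb).2.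
split=> [dep c d cM dN x Ux|umb c x cM cx]; last exact: (umb_weyl c x cM cx umb).1.
have [Fs iso] := fi c d cM dN; have [cx _] := Ux.
exact: (chart_umbilical (op c d cM dN) (Gs c d cM) (fun y => Gp c d y cM)
  (cod_open d dN) (metric_smooth dN) (G'p d dN) Fs (FU c d) iso (G'k d dN) n4 Ux
  (wint c d cM dN x Ux) (dep c x cM cx)).
Qed.
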